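(* Let $\mathcal{GP}_{n,N}$ be the moduli space of twisted Grassmann $n$-gons in $\mathrm{Gr}(N,3N)$. There is a bijection between $\mathcal{GP}_{n,N}$ and $\mathrm{GL}_N^{2n+1}/\mathrm{Ad}\,\mathrm{GL}_N$, the space of $(2n+1)$-tuples of invertible $N\times N$ real matrices up to simultaneous conjugation. Therefore $\dim\mathcal{GP}_{n,N}=2nN^2+1$.
   Context: $\mathrm{Gr}(N,3N)$ is the Grassmannian of $N$-dimensional subspaces of $\mathbb{R}^{3N}$; points are represented by rank-$N$ real $3N\times N$ matrices up to the right action of $\mathrm{GL}_N=\mathrm{GL}_N(\mathbb{R})$. A twisted Grassmann $n$-gon is a bi-infinite sequence $(p_i)_{i\in\mathbb{Z}}$ of points of $\mathrm{Gr}(N,3N)$ with $p_{i+n}=Mp_i$ for all $i$, where $M\in\mathrm{PGL}_{3N}$ is the monodromy. A lift is a sequence $(V_i)$ of $3N\times N$ matrices with column spans $p_i$; it is twisted if $V_{i+n}=MV_i$ for all $i$ with $M\in\mathrm{GL}_{3N}$ representing the monodromy. Polygons are assumed nondegenerate: for a lift, each $3N\times3N$ matrix $(V_i\,V_{i+1}\,V_{i+2})$ is invertible and the matrices in $V_{i+3}=V_iA_i+V_{i+1}B_i+V_{i+2}C_i$ satisfy $A_i,B_i,C_i\in\mathrm{GL}_N$. Let $\mathcal{TL}_{n,N}$ be the set of twisted lifts, i.e. of tuples $(V_1,\dots,V_n,M)$ with $M\in\mathrm{GL}_{3N}$ arising from twisted lifts of such polygons. The moduli space $\mathcal{GP}_{n,N}$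 of twisted Grassmann $n$-gons up to the action of $\mathrm{PGL}_{3N}$ is realized as the quotient of $\mathcal{TL}_{n,N}$ by the action of $\mathrm{GL}_{3N}$ ($V_i\mapsto gV_i$, $M\mapsto gMg^{-1}$) and by changes of the twisted lift ($V_i\mapsto V_iG_i$, $G_i\in\mathrm{GL}_N$, $G_{i+n}=G_i$). *)

(* Defs.v *)
From HB Require Import structures.
From mathcomp Require Import all_boot all_order all_algebra.
From mathcomp Require Import all_classical all_reals all_analysis.

Set Implicit Arguments.
Unset Strict Implicit.
Unset Printing Implicit Defensive.

Import Order.TTheory GRing.Theory Num.Theory.
Import numFieldNormedType.Exports.

Local Open Scope classical_set_scope.
Local Open Scope ring_scope.
Local Open Scope quotient_scope.

(* The ambient dimension 3N is written N + N + N, so that the block matrix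
   (V_i V_{i+1} V_{i+2}) is square on the nose. *)

Section TwistedLifts.
Variables (R : realType) (n N : nat).

Definition block3 (V : int -> 'M[R]_(N + N + N, N)) (i : int) :
    'M[R]_(N + N + N) :=
  row_mx (row_mx (V i) (V (i + 1))) (V (i + 2)).

(* The coefficients A, B, C are uniquely determined by V and i as soon as
   block3 V i is invertible. *)
Definition nondegenerate (V : int -> 'M[R]_(N + N + N, N)) : Prop :=
  forall i : int, block3 V i \in unitmx /\
    exists A B C : 'M[R]_N,
      [/\ A \in unitmx, B \in unitmx, C \in unitmx &
          V (i + 3) = V i *m A + V (i + 1) *m B + V (i + 2) *m C].

(* V is a lift, twisted with monodromy M, of a nondegenerate twisted Grassmann
   n-gon; the n-gon itself is the sequence of the column spans of the V i,
   which lie in Gr(N, 3N) by the rank condition. *)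
Definition twisted_lift (V : int -> 'M[R]_(N + N + N, N))
    (M : 'M[R]_(N + N + N)) : Prop :=
  [/\ forall i, \rank (V i) = N,
      M \in unitmx,
      forall i, V (i + n%:Z) = M *m V i &
      nondegenerate V].

Definition lift_space : Type :=
  (prod_topology (fun _ : 'I_n => 'M[R]_(N + N + N, N)) *
   'M[R]_(N + N + N))%type.

(* The tuples (V_1, ..., V_n, M); position i : 'I_n holds V_(i+1). *)
Definition TL_set : set lift_space :=
  [set w | exists2 V : int -> 'M[R]_(N + N + N, N),
     twisted_lift V w.2 & forall i : 'I_n, w.1 i = V (i.+1)%:Z].

Definition TL : Type := set_type TL_set.

(* Same orbit under GL_3N and the changes of twisted lift. An n-periodic
   sequence (G_i) is given by its terms G_1, ..., G_n; such a change of lift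
   leaves M itself fixed, so M is not taken up to scalars here. *)
Definition lift_equiv (w w' : TL) : Prop :=
  exists g : 'M[R]_(N + N + N), exists G : 'I_n -> 'M[R]_N,
    [/\ g \in unitmx, forall i, G i \in unitmx,
        forall i, (val w').1 i = g *m (val w).1 i *m G i &
        (val w').2 = g *m (val w).2 *m invmx g].

Definition lift_equivb (w w' : TL) : bool := `[< lift_equiv w w' >].

Lemma lift_equivb_refl : reflexive lift_equivb.
Proof.
move=> w; apply/asboolP; exists 1%:M, (fun=> 1%:M); split.
- exact: unitmx1.
- by move=> _; exact: unitmx1.
- by move=> i; rewrite mul1mx mulmx1.
- by rewrite mul1mx invmx1 mulmx1.
Qed.

Lemma lift_equiv_sym (w w' : TL) : lift_equiv w w' -> lift_equiv w' w.
Proof.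
case=> g [G [gU GU eV eM]]; exists (invmx g), (fun i => invmx (G i)); split.
- by rewrite unitmx_inv.
- by move=> i; rewrite unitmx_inv.
- by move=> i; rewrite eV !mulmxA mulVmx// mul1mx mulmxK.
- by rewrite eM invmxK !mulmxA mulVmx// mul1mx mulmxKV.
Qed.

Lemma lift_equivb_sym : symmetric lift_equivb.
Proof.
by move=> w w'; apply/asboolP/asboolP; exact: lift_equiv_sym.
Qed.

Lemma lift_equivb_trans : transitive lift_equivb.
Proof.
move=> w2 w1 w3 /asboolP[g [G [gU GU eV eM]]] /asboolP[h [H [hU HU eV' eM']]].
apply/asboolP; exists (h *m g), (fun i => G i *m H i); split.
- by rewrite unitmx_mul hU gU.
- by move=> i; rewrite unitmx_mul GU HU.
- by move=> i; rewrite eV' eV !mulmxA.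
- have -> : invmx (h *m g) = invmx g *m invmx h.
    apply: (can_inj (mulKmx (_ : h *m g \in unitmx))).
      by rewrite unitmx_mul hU gU.
    rewrite mulmxV ?unitmx_mul ?hU ?gU//.
    by rewrite !mulmxA mulmxK// mulmxV.
  by rewrite eM' eM !mulmxA.
Qed.

Definition lift_equiv_rel : equiv_rel TL :=
  EquivRel lift_equivb lift_equivb_refl lift_equivb_sym lift_equivb_trans.

(* The moduli space of twisted Grassmann n-gons in Gr(N, 3N). *)
Definition GP : topologicalType := quotient_topology {eq_quot lift_equiv_rel}.

End TwistedLifts.

Section ConjugationClasses.
Variables (R : realType) (m N : nat).

Definition GL_tuples_set : set (prod_topology (fun _ : 'I_m => 'M[R]_N)) :=
  [set X | forall i, X i \in unitmx].

Definition GL_tuples : Type := set_type GL_tuples_set.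

Definition conj_equiv (X Y : GL_tuples) : Prop :=
  exists2 g : 'M[R]_N, g \in unitmx &
    forall i, val Y i = g *m val X i *m invmx g.

Definition conj_equivb (X Y : GL_tuples) : bool := `[< conj_equiv X Y >].

Lemma conj_equivb_refl : reflexive conj_equivb.
Proof.
move=> X; apply/asboolP; exists 1%:M => [|i]; first exact: unitmx1.
by rewrite mul1mx invmx1 mulmx1.
Qed.

Lemma conj_equiv_sym (X Y : GL_tuples) : conj_equiv X Y -> conj_equiv Y X.
Proof.
case=> g gU e; exists (invmx g) => [|i]; first by rewrite unitmx_inv.
by rewrite e invmxK !mulmxA mulVmx// mul1mx mulmxKV.
Qed.

Lemma conj_equivb_sym : symmetric conj_equivb.
Proof.
by move=> X Y; apply/asboolP/asboolP; exact: conj_equiv_sym.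
Qed.

Lemma conj_equivb_trans : transitive conj_equivb.
Proof.
move=> Y X Z /asboolP[g gU e] /asboolP[h hU e'].
have hgU : h *m g \in unitmx by rewrite unitmx_mul hU gU.
apply/asboolP; exists (h *m g) => // i.
have -> : invmx (h *m g) = invmx g *m invmx h.
  apply: (can_inj (mulKmx hgU)).
  by rewrite mulmxV// !mulmxA mulmxK// mulmxV.
by rewrite e' e !mulmxA.
Qed.

Definition conj_equiv_rel : equiv_rel GL_tuples :=
  EquivRel conj_equivb conj_equivb_refl conj_equivb_sym conj_equivb_trans.

Definition GL_tuples_mod_Ad : topologicalType :=
  quotient_topology {eq_quot conj_equiv_rel}.

End ConjugationClasses.

(* x has an open neighbourhood, contained in U, that is homeomorphic to an open
   subset of R^d. *)
Definition locally_euclidean_at (R : realType) (d : nat) (T : topologicalType)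
    (U : set T) (x : T) : Prop :=
  exists W : set T, exists O : set 'rV[R]_d, exists phi : T -> 'rV[R]_d,
    [/\ [/\ open W, W x & W `<=` U],
        open O,
        set_bij W O phi,
        {within W, continuous phi} &
        forall A : set T, open A -> A `<=` W -> open (phi @` A)].

(* dim T = d. An orbit space such as GP is in general neither Hausdorff nor
   everywhere a manifold: its dimension is that of the generic locus. By
   invariance of domain there is at most one such d. *)
Definition has_dim (R : realType) (T : topologicalType) (d : nat) : Prop :=
  exists U : set T,
    [/\ open U, dense U, U !=set0 &
        forall x, U x -> @locally_euclidean_at R d T U x].

(* Main.v *)
(* The recurrence V_(i+3) = V_i A_i + V_(i+1) B_i + V_(i+2) C_i determines a
   twisted lift from an initial frame and from the periodic coefficients.  Going
   to the non-periodic lift u_i = V_i P_i^-1, P_i being the product of the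
   preceding C_j, turns every C_i into 1, makes the other coefficients periodic up
   to conjugation by the holonomy P_n, and leaves a single overall conjugation as
   the remaining freedom: the moduli space is homeomorphic to the space of
   conjugation classes of the 2n + 1 matrices (A_i, B_i, P_n).

   For the dimension, conjugate a tuple (X_0, X_1, X_2, ...) so that X_0 is a
   companion matrix and its cyclic vector e_0 is an eigenvector of X_1; e_0 being
   unique up to a scalar, the remaining entries are local coordinates on the
   quotient as soon as the eigenvalue is isolated in an open way.  A generic X_1
   may have no real eigenvalue, but the sum of c_ij X_0^i X_2 X_0^j, over
   0 <= i, j < N, takes every value as c varies when X_0 and X_2 are generic, and
   adding such a sum to X_1 is an equivariant automorphism of the space of tuples.
   Eigenvectors of nearby tuples come from the intermediate value theorem applied
   to the characteristic polynomial and from the adjugate matrix, hence no inverse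
   function theorem is needed.  *)
Require Import Defs.
From HB Require Import structures.
From mathcomp Require Import all_boot all_order all_algebra.
From mathcomp Require Import all_classical all_reals all_analysis.
From mathcomp Require Import zify.

Set Implicit Arguments.
Unset Strict Implicit.
Unset Printing Implicit Defensive.

Import Order.TTheory GRing.Theory Num.Theory.
Import numFieldNormedType.Exports.

Local Open Scope classical_set_scope.
Local Open Scope ring_scope.
Local Open Scope quotient_scope.

(** * Limits of matrices *)

Section Convergence.
Variables (R : realType) (T : Type) (F : set_system T).
Hypothesis FF : Filter F.

Lemma cvg_mx m n (f : T -> 'M[R]_(m, n)) (M : 'M[R]_(m, n)) :
  (forall i j, f x i j @[x --> F] --> M i j) -> f @ F --> M.
Proof.
move=> H A [P MP sPA]; apply: (@filterS _ F _ [set x | forall i j, P i j (f x i j)]).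
  by move=> x Px; exact: sPA.
apply: filter_forall => i; apply: filter_forall => j; exact/H/MP.
Qed.

Lemma cvg_mx_entry m n (f : T -> 'M[R]_(m, n)) (M : 'M[R]_(m, n)) i j :
  f @ F --> M -> f x i j @[x --> F] --> M i j.
Proof. move=> fM A MA; apply: (fM [set N : 'M[R]_(m, n) | A (N i j)]).
exact: (@coord_continuous R m n i j M A MA). Qed.

Lemma cvg_mulmx m n p (f : T -> 'M[R]_(m, n)) (g : T -> 'M[R]_(n, p))
    (A : 'M[R]_(m, n)) (B : 'M[R]_(n, p)) :
  f @ F --> A -> g @ F --> B -> (f x *m g x) @[x --> F] --> A *m B.
Proof.
move=> fA gB; apply: cvg_mx => i j; rewrite mxE.
under eq_cvg => x do rewrite mxE.
apply: cvg_big => [|k _]; first by move=> x; exact: add_continuous.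
by apply: cvgM; exact: cvg_mx_entry.
Qed.

Lemma cvg_prodr (I : Type) (r : seq I) (P : pred I) (f : I -> T -> R) (a : I -> R) :
  (forall i, P i -> f i x @[x --> F] --> a i) ->
  \prod_(i <- r | P i) f i x @[x --> F] --> \prod_(i <- r | P i) a i.
Proof.
by move=> fa; apply: cvg_big => // x; exact: mul_continuous.
Qed.

Lemma cvg_det n (f : T -> 'M[R]_n) (A : 'M[R]_n) :
  f @ F --> A -> \det (f x) @[x --> F] --> \det A.
Proof.
move=> fA; apply: cvg_big => [|s _]; first by move=> x; exact: add_continuous.
apply: cvgM; first exact: cvg_cst.
by apply: cvg_prodr => i _; exact: cvg_mx_entry.
Qed.

Lemma cvg_adj n (f : T -> 'M[R]_n) (A : 'M[R]_n) :
  f @ F --> A -> \adj (f x) @[x --> F] --> \adj A.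
Proof.
move=> fA; apply: cvg_mx => i j; rewrite mxE.
under eq_cvg => x do rewrite mxE.
apply: cvgM; first exact: cvg_cst.
apply: cvg_det; apply: cvg_mx => a b; rewrite !mxE.
by under eq_cvg => x do rewrite !mxE; exact: cvg_mx_entry.
Qed.

Lemma near_unitmx n (f : T -> 'M[R]_n) (A : 'M[R]_n) :
  A \in unitmx -> f @ F --> A -> \forall x \near F, f x \in unitmx.
Proof.
move=> Au /cvg_det fA; have dA : \det A != 0 by rewrite -unitfE -unitmxE.
apply: filterS (cvgr_neq0 _ fA dA) => x.
by rewrite unitmxE unitfE.
Qed.

Lemma cvg_invmx n (f : T -> 'M[R]_n) (A : 'M[R]_n) :
  A \in unitmx -> f @ F --> A -> invmx (f x) @[x --> F] --> invmx A.
Proof.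
move=> Au fA; have fu := near_unitmx Au fA.
have dA : \det A != 0 by rewrite -unitfE -unitmxE.
apply: (@cvg_trans _ ((fun x => (\det (f x))^-1 *: \adj (f x)) @ F)).
  apply: near_eq_cvg; apply: filterS fu => x fxu.
  by rewrite /invmx fxu.
rewrite /invmx Au; apply: cvgZ; last exact: cvg_adj.
by apply: cvgV => //; exact: cvg_det.
Qed.

Lemma cvg_row_mx m n p (f : T -> 'M[R]_(m, n)) (g : T -> 'M[R]_(m, p))
    (A : 'M[R]_(m, n)) (B : 'M[R]_(m, p)) :
  f @ F --> A -> g @ F --> B -> row_mx (f x) (g x) @[x --> F] --> row_mx A B.
Proof.
move=> fA gB; apply: cvg_mx => i j; rewrite mxE.
under eq_cvg => x do rewrite mxE.
by case: (fintype.split j) => k; exact: cvg_mx_entry.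
Qed.

Lemma cvg_usubmx m n p (f : T -> 'M[R]_(m + n, p))
    (A : 'M[R]_(m + n, p)) :
  f @ F --> A -> usubmx (f x) @[x --> F] --> usubmx A.
Proof.
move=> fA; apply: cvg_mx => i j; rewrite mxE.
by under eq_cvg => x do rewrite mxE; exact: cvg_mx_entry.
Qed.

Lemma cvg_dsubmx m n p (f : T -> 'M[R]_(m + n, p))
    (A : 'M[R]_(m + n, p)) :
  f @ F --> A -> dsubmx (f x) @[x --> F] --> dsubmx A.
Proof.
move=> fA; apply: cvg_mx => i j; rewrite mxE.
by under eq_cvg => x do rewrite mxE; exact: cvg_mx_entry.
Qed.

Lemma cvg_expmx n k (f : T -> 'M[R]_n) (A : 'M[R]_n) :
  f @ F --> A -> f x ^+ k @[x --> F] --> A ^+ k.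
Proof.
move=> fA; elim: k => [|k IH]; first exact: cvg_cst.
rewrite exprS; under eq_cvg => x do rewrite exprS.
exact: cvg_mulmx.
Qed.

Lemma cvg_proj m p q (f : T -> prod_topology (fun _ : 'I_m => 'M[R]_(p, q)))
    (Y : prod_topology (fun _ : 'I_m => 'M[R]_(p, q))) i :
  f @ F --> Y -> f x i @[x --> F] --> Y i.
Proof.
move=> fY A YA; apply: (fY [set Z : prod_topology _ | A (Z i)]).
exact: (@proj_continuous 'I_m (fun=> 'M[R]_(p, q)) i Y A YA).
Qed.

Lemma cvg_prod_topology (I : Type) (K : I -> topologicalType)
    (f : T -> prod_topology K) (g : prod_topology K) :
  (forall i, f x i @[x --> F] --> g i) -> f @ F --> g.
Proof.
move=> H; apply/cvg_sup => i A [B [[C oC CB] Bg] BA].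
apply: (filterS BA); rewrite -CB; apply: (H i).
by apply: open_nbhs_nbhs; split => //; move: Bg; rewrite -CB.
Qed.

Lemma cvg_set_type (X : topologicalType) (A : set X) (f : T -> set_type A)
    (a : set_type A) :
  val (f x) @[x --> F] --> val a -> f @ F --> a.
Proof.
move=> H B [C [[D oD DC] Ca] CB].
apply: (filterS CB); rewrite -DC; apply: H.
by apply: open_nbhs_nbhs; split => //; move: Ca; rewrite -DC.
Qed.

End Convergence.

(** * Quotient spaces and charts *)

(** [repr] need not be continuous, but precomposed with the projections the induced maps become [F]
    and [G] followed by a projection, because [F] and [G] respect the relations. The universal
    property of the quotient then gives continuity. *)
Lemma quotient_homeo (T1 T2 : topologicalType) (e1 : equiv_rel T1)
    (e2 : equiv_rel T2) (F : T1 -> T2) (G : T2 -> T1) :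
  continuous F -> continuous G ->
  (forall x y, e1 x y -> e2 (F x) (F y)) ->
  (forall x y, e2 x y -> e1 (G x) (G y)) ->
  (forall x, e1 (G (F x)) x) -> (forall y, e2 (F (G y)) y) ->
  exists f : quotient_topology {eq_quot e1} -> quotient_topology {eq_quot e2},
  exists g : quotient_topology {eq_quot e2} -> quotient_topology {eq_quot e1},
    [/\ cancel f g, cancel g f, continuous f & continuous g].
Proof.
move=> cF cG eF eG GF FG.
pose f (q : quotient_topology {eq_quot e1}) : quotient_topology {eq_quot e2} :=
  \pi_(quotient_topology {eq_quot e2}) (F (repr q)).
pose g (q : quotient_topology {eq_quot e2}) : quotient_topology {eq_quot e1} :=
  \pi_(quotient_topology {eq_quot e1}) (G (repr q)).
have fE x : f (\pi_(quotient_topology {eq_quot e1}) x) =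
            \pi_(quotient_topology {eq_quot e2}) (F x).
  by apply/eqmodP; apply: eF; apply/eqmodP; rewrite reprK.
have gE x : g (\pi_(quotient_topology {eq_quot e2}) x) =
            \pi_(quotient_topology {eq_quot e1}) (G x).
  by apply/eqmodP; apply: eG; apply/eqmodP; rewrite reprK.
exists f, g; split.
- move=> q; rewrite -[q in LHS]reprK fE gE -[q in RHS]reprK.
  by apply/eqmodP; exact: GF.
- move=> q; rewrite -[q in LHS]reprK gE fE -[q in RHS]reprK.
  by apply/eqmodP; exact: FG.
- apply/quotient_continuous.
  rewrite (_ : f \o _ = \pi_(quotient_topology {eq_quot e2}) \o F).
    by move=> x; apply: continuous_comp; [exact: cF | exact: pi_continuous].
  by apply/funext => x; exact: fE.
- apply/quotient_continuous.
  rewrite (_ : g \o _ = \pi_(quotient_topology {eq_quot e1}) \o G).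
    by move=> x; apply: continuous_comp; [exact: cG | exact: pi_continuous].
  by apply/funext => x; exact: gE.
Qed.

Lemma has_dim_homeo (R : realType) (T T' : topologicalType) (d : nat)
    (f : T -> T') (g : T' -> T) :
  cancel f g -> cancel g f -> continuous f -> continuous g ->
  has_dim R T' d -> has_dim R T d.
Proof.
move=> fK gK /continuousP cf /continuousP cg [U [oU dU [x0 Ux0] chart]].
exists (f @^-1` U); split; first exact: cf.
- move=> A [a Aa] oA.
  have ne : g @^-1` A !=set0 by exists (f a); rewrite /= fK.
  have [y [gAy Uy]] := dU _ ne (cg _ oA).
  by exists (g y); split => //=; rewrite gK.
- by exists (g x0); rewrite /= gK.
- move=> x /chart[W [V [phi [[oW Wx WU] oV [pO pinj psurj] cphi ophi]]]].
  exists (f @^-1` W), V, (phi \o f); split => //.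
  + by split => //; [exact: cf | move=> y /WU].
  + split.
    * by move=> y /= /pO.
    * move=> y z; rewrite !inE /= => Wy Wz e.
      by apply: (can_inj fK); apply: pinj => //; rewrite inE.
    * by move=> r /psurj[w Ww <-]; exists (g w); rewrite /= gK.
  + have oW' : open (f @^-1` W) by exact: cf.
    move: cphi; rewrite !continuous_open_subspace// => cphi.
    move=> y; rewrite inE => Wy; apply: continuous_comp.
      by move=> A; have /continuousP := cf; apply.
    by apply: cphi; rewrite inE.
  + move=> A oA AW; rewrite -image_comp.
    have -> : f @` A = g @^-1` A.
      apply/seteqP; split => [_ [a Aa <-]|y Agy] /=; first by rewrite fK.
      by exists (g y).
    by apply: ophi; [exact: cg | move=> y /AW /=; rewrite gK].
Qed.

(** A chart given by its inverse [psi]. The roles are exchanged: [phi] is continuous because [psi]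
    is open, and open because [psi] is continuous on [O]. *)
Lemma locally_euclidean_param (R : realType) (d : nat) (T : topologicalType)
    (U : set T) (O : set 'rV[R]_d) (psi : 'rV[R]_d -> T) (x : T) :
  open O -> (forall r s, O r -> O s -> psi r = psi s -> r = s) ->
  (forall B, open B -> B `<=` O -> open (psi @` B)) ->
  (forall A, open A -> open (O `&` psi @^-1` A)) ->
  psi @` O `<=` U -> (psi @` O) x -> @locally_euclidean_at R d T U x.
Proof.
move=> oO pinj popen pcont WU Wx.
have oW : open (psi @` O) by exact: popen.
(* The inverse of [psi] by choice; the default 0 is taken only outside the image of [O]. *)
pose phi y := xget (0 : 'rV[R]_d) [set r | O r /\ psi r = y].
have phiP y : (psi @` O) y -> O (phi y) /\ psi (phi y) = y.
  move=> [r Or ry]; exact: (@xgetPex _ 0 [set r | O r /\ psi r = y]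
    (ex_intro _ r (conj Or ry))).
have phiK r : O r -> phi (psi r) = r.
  by move=> Or; have [] := phiP (psi r) (ex_intro2 _ _ r Or erefl);
    move=> O1 /pinj; apply.
exists (psi @` O), O, phi; split => //.
- split.
  + by move=> y /phiP[].
  + move=> y z; rewrite !inE => /phiP[_ yE] /phiP[_ zE] e.
    by rewrite -yE e zE.
  + by move=> r Or; exists (psi r); [exists r | exact: phiK].
- rewrite continuous_open_subspace// => y; rewrite inE => Wy.
  move=> B; rewrite nbhsE => -[B' [oB' B'y] B'B].
  have [Oy yE] := phiP _ Wy.
  apply: (@filterS _ _ _ (psi @` (O `&` B'))).
    by move=> _ [r [Or Br] <-]; rewrite /= phiK//; exact: B'B.
  apply: open_nbhs_nbhs; split; first by apply: popen; [exact: openI | move=> ? []].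
  by exists (phi y).
- move=> A oA AW.
  rewrite (_ : phi @` A = O `&` psi @^-1` A); first exact: pcont.
  apply/seteqP; split => [_ [y Ay <-]|r [Or Ar]].
    by have [Oy yE] := phiP y (AW _ Ay); split => //=; rewrite yE.
  by exists (psi r) => //; exact: phiK.
Qed.

(** * Normal forms of tuples of matrices up to conjugation *)

(** In the l^1 norm, [w *m D] is at most the sum of the [|D i j|] times [w], hence at most half of
    [w]; a factor above 1/2 then forces [w = 0]. *)
Lemma small_mx_no_eigenvector (R : realFieldType) k (D : 'M[R]_k) (a : R)
    (w : 'rV[R]_k) :
  2^-1 < a -> \sum_i \sum_j `|D i j| < 2^-1 -> w *m D = a *: w -> w = 0.
Proof.
move=> a_gt D_lt wD; set s := \sum_j `|w 0 j|.
have s_ge0 : 0 <= s by apply: sumr_ge0.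
have w_le j : `|w 0 j| <= s by rewrite /s (bigD1 j)//= lerDl sumr_ge0.
have : a * s <= 2^-1 * s.
  rewrite /s mulr_sumr.
  apply: (@le_trans _ _ (\sum_j \sum_i `|D i j| * s)).
    apply: ler_sum => j _; have /matrixP/(_ 0 j) := wD.
    rewrite !mxE => e; have a0 : 0 <= a by apply: le_trans (ltW a_gt).
    rewrite -[a in leLHS]ger0_norm// -normrM -e.
    apply: le_trans (ler_norm_sum _ _ _) _; apply: ler_sum => i _.
    by rewrite normrM mulrC ler_wpM2l.
  rewrite exchange_big/=; under eq_bigr do rewrite -mulr_suml.
  by rewrite -mulr_suml ler_wpM2r// ltW.
rewrite -subr_le0 -mulrBl pmulr_rle0 ?subr_gt0// => s_le0.
apply/rowP => j; rewrite mxE; apply/normr0_eq0/eqP.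
by rewrite eq_le normr_ge0 (le_trans (w_le j)).
Qed.

(** * Word sums and Krylov matrices *)

Section Words.
Variable k : nat.

(** The ring is kept general because [generic_line] uses these constructions on matrices of
    polynomials. *)
Definition word_sum (S : comNzRingType) (A B c : 'M[S]_k.+1) : 'M[S]_k.+1 :=
  \sum_i \sum_j c i j *: (A ^+ i * B * A ^+ j).

Definition word_mx (S : comNzRingType) (A B : 'M[S]_k.+1) :=
  lin_mx (word_sum A B).

(** Invertible exactly when [v] is a cyclic vector of [A]; its columns are then the basis in which
    [A] becomes a companion matrix. *)
Definition krylov (S : comNzRingType) (A : 'M[S]_k.+1) (v : 'cV[S]_k.+1) :
    'M[S]_k.+1 :=
  \matrix_(i, j) (A ^+ j *m v) i 0.

Lemma word_sum_linear (S : comNzRingType) (A B : 'M[S]_k.+1) :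
  linear (word_sum A B).
Proof.
move=> a c c'; rewrite /word_sum scaler_sumr -big_split; apply: eq_bigr => i _.
rewrite /= scaler_sumr -big_split; apply: eq_bigr => j _ /=.
by rewrite !mxE scalerDl scalerA.
Qed.

HB.instance Definition _ (S : comNzRingType) (A B : 'M[S]_k.+1) :=
  GRing.isLinear.Build S 'M[S]_k.+1 'M[S]_k.+1 *:%R (word_sum A B)
    (word_sum_linear A B).

Lemma map_word_sum (S S' : comNzRingType) (f : {rmorphism S -> S'})
    (A B c : 'M[S]_k.+1) :
  map_mx f (word_sum A B c) =
  word_sum (map_mx f A) (map_mx f B) (map_mx f c).
Proof.
rewrite /word_sum rmorph_sum; apply: eq_bigr => i _.
rewrite rmorph_sum; apply: eq_bigr => j _ /=.
by rewrite map_mxZ mxE !rmorphM !rmorphXn.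
Qed.

Lemma map_word_mx (S S' : comNzRingType) (f : {rmorphism S -> S'})
    (A B : 'M[S]_k.+1) :
  map_mx f (word_mx A B) = word_mx (map_mx f A) (map_mx f B).
Proof.
rewrite /word_mx; apply: map_lin_mx => c.
exact: map_word_sum.
Qed.

Lemma map_krylov (S S' : comNzRingType) (f : {rmorphism S -> S'})
    (A : 'M[S]_k.+1) v :
  map_mx f (krylov A v) = krylov (map_mx f A) (map_mx f v).
Proof.
apply/matrixP => i j; rewrite [LHS]mxE [krylov _ _ _ _]mxE [RHS]mxE.
by rewrite -rmorphXn/= -map_mxM [RHS]mxE.
Qed.

Variable R : fieldType.
Implicit Types (A B c g : 'M[R]_k.+1).

Lemma word_sum_surj A B C :
  word_mx A B \in unitmx -> exists c, word_sum A B c = C.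
Proof.
move=> Wu; exists (vec_mx (mxvec C *m invmx (word_mx A B))).
by apply: (can_inj mxvecK); rewrite -mul_vec_lin vec_mxK mulmxKV.
Qed.

Lemma conjX g A n : g \in unitmx -> (g * A * g^-1) ^+ n = g * A ^+ n * g^-1.
Proof.
move=> gu; elim: n => [|n IH]; first by rewrite !expr0 mulr1 mulrV.
by rewrite !exprS IH !mulrA mulrVK.
Qed.

Lemma word_sum_conj g A B c : g \in unitmx ->
  word_sum (g * A * g^-1) (g * B * g^-1) c = g * word_sum A B c * g^-1.
Proof.
move=> gu; rewrite /word_sum mulr_sumr mulr_suml; apply: eq_bigr => i _.
rewrite mulr_sumr mulr_suml; apply: eq_bigr => j _.
by rewrite !conjX// !mulrA !mulrVK// -scalerAr -scalerAl !mulrA.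
Qed.

(* The last column is unconstrained. *)
Definition companion_like A :=
  forall a b : 'I_k.+1, (b < k)%N -> A a b = (a == b.+1 :> nat)%:R.

Lemma companion_likeX A : companion_like A ->
  forall n (ltnk : (n < k.+1)%N), A ^+ n *m delta_mx 0 0 =
    delta_mx (Ordinal ltnk) 0 :> 'cV[R]_k.+1.
Proof.
move=> cA; elim=> [|n IH] ltnk; first by
    rewrite expr0 mul1mx; congr delta_mx; exact: val_inj.
rewrite exprS -mulmxA (IH (ltnW ltnk)) -colE; apply/colP => a.
by rewrite !mxE cA// andbT -val_eqE.
Qed.

Lemma krylov_companion A (x : R) :
  companion_like A -> krylov A (x *: delta_mx 0 0) = x%:M.
Proof.
move=> cA; apply/matrixP => i j; rewrite mxE -scalemxAr.
rewrite (companion_likeX cA (ltn_ord j)) !mxE eqxx andbT -val_eqE /=.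
exact: mulr_natr.
Qed.

Lemma krylov_conj_companion A v :
  krylov A v \in unitmx ->
  companion_like ((krylov A v)^-1 * A * krylov A v).
Proof.
move=> gu a b ltbk; set g := krylov A v.
(* [A] sends each column of [g] but the last to the next one, so that in the basis [g] it shifts the
   standard vectors. *)
have e : A *m col b g = col (Ordinal (ltbk : b.+1 < k.+1)%N) g.
  apply/colP => i; rewrite [RHS]mxE [RHS]mxE exprS -mulmxA [LHS]mxE [RHS]mxE.
  by apply: eq_bigr => j _; congr (_ * _); rewrite !mxE.
have -> : (g^-1 * A * g) a b = (invmx g *m (A *m col b g)) a 0.
  by rewrite colE !mulmxA -colE [RHS]mxE.
by rewrite e colE mulmxA mulVmx// mul1mx mxE eqxx andbT -val_eqE.
Qed.

Lemma krylov_col0 A v : krylov A v *m delta_mx 0 0 = v.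
Proof.
by rewrite -colE; apply/colP => i; rewrite [LHS]mxE [LHS]mxE expr0 mul1mx.
Qed.

End Words.

(** * Matrices with an isolated real eigenvalue *)

Section DominantColumn.
Variables (R : realFieldType) (k : nat).
Implicit Types (Y A : 'M[R]_k.+1).

(* The column [0] of [Y] is an eigenvector, and its eigenvalue is the only real
   eigenvalue of [Y] above [1/2]. *)
Definition dominant_col0 Y :=
  [/\ forall a, a != 0 -> Y a 0 = 0, 2^-1 < Y 0 0 &
      \sum_i \sum_j `|row' 0 (col' 0 Y) i j| < 2^-1].

(** Column 0 of [Y] vanishes below the corner, so the entries of [y] other than [y 0 0] satisfy the
    eigenvalue equation for the small block, which has no eigenvalue above 1/2. *)
Lemma dominant_eigenvector Y (a : R) (y : 'cV[R]_k.+1) :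
  dominant_col0 Y -> 2^-1 < a -> Y *m y = a *: y -> y = y 0 0 *: delta_mx 0 0.
Proof.
move=> [Y0 _ Dlt] a_gt Yy.
suff w0 : (row' 0 y)^T = 0 :> 'rV_k.
  apply/colP => i; rewrite !mxE andbT; case: (unliftP 0 i) => [j|] ->.
    have /rowP/(_ j) := w0; rewrite !mxE => ->.
    by rewrite eq_sym (negbTE (neq_lift _ _)) mulr0.
  by rewrite eqxx mulr1.
apply: (@small_mx_no_eigenvector _ _ (row' 0 (col' 0 Y))^T a) => //.
  rewrite exchange_big/=; under eq_bigr do under eq_bigr do rewrite mxE.
  exact: Dlt.
apply/rowP => j; have /colP/(_ (lift 0 j)) := Yy.
rewrite !mxE big_ord_recl Y0 ?mul0r ?add0r; last by rewrite eq_sym neq_lift.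
by move=> <-; apply: eq_bigr => i _; rewrite !mxE mulrC.
Qed.

Lemma char_col0 Y (t : R) : (forall a, a != 0 -> Y a 0 = 0) ->
  \det (t%:M - Y) = (t - Y 0 0) * cofactor (t%:M - Y) 0 0.
Proof.
move=> Y0; rewrite (expand_det_col _ 0) (bigD1 0)//= big1 ?addr0.
  by rewrite !mxE eqxx mulr1n.
by move=> i i0; rewrite !mxE Y0// (negbTE i0) mulr0n subr0 mul0r.
Qed.

(** The cofactor is the characteristic polynomial of the small block at [Y 0 0], which is no
    eigenvalue of that block. By [char_col0], [Y 0 0] is thus a simple root of the characteristic
    polynomial of [Y]. *)
Lemma dominant_cofactor Y :
  dominant_col0 Y -> cofactor ((Y 0 0)%:M - Y) 0 0 != 0.
Proof.
move=> [Y0 agt Dlt]; rewrite /cofactor expr0 mul1r.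
apply/negP => /det0P[w w0 wM]; move/negP: w0; apply; apply/eqP.
apply: (small_mx_no_eigenvector agt Dlt).
apply/eqP; rewrite -subr_eq0 -opprB oppr_eq0 -mul_mx_scalar -mulmxBr -wM.
apply/eqP; congr (_ *m _); apply/matrixP => i j; rewrite !mxE.
by rewrite (inj_eq lift_inj).
Qed.

(** A matrix times its adjugate is its determinant, here 0, so this column is an eigenvector. The
    adjugate gives a formula for the eigenvector that is polynomial in the matrix and the
    eigenvalue, and so passes to nearby matrices. *)
Lemma dominant_adj Y : dominant_col0 Y ->
  \adj ((Y 0 0)%:M - Y) *m delta_mx 0 0 =
  cofactor ((Y 0 0)%:M - Y) 0 0 *: delta_mx 0 0 :> 'cV_k.+1.
Proof.
move=> Yd; have [Y0 agt _] := Yd; set M := _ - Y; set v := _ *m _.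
have Yv : Y *m v = Y 0 0 *: v.
  apply/eqP; rewrite eq_sym -subr_eq0 -mul_scalar_mx -mulmxBl -/M mulmxA.
  by rewrite mul_mx_adj char_col0// subrr mul0r mul_scalar_mx scale0r.
rewrite (dominant_eigenvector Yd agt Yv); congr (_ *: _).
by rewrite /v -colE !mxE.
Qed.

End DominantColumn.

(** * Rigidity of normal forms under conjugation *)

Section NormalForm.
Variables (R : realFieldType) (k m : nat) (i0 i1 : 'I_m).
Implicit Types (X Y : 'I_m -> 'M[R]_k.+1).

Definition conj_tuple (g : 'M[R]_k.+1) X : 'I_m -> 'M[R]_k.+1 :=
  fun i => g * X i * g^-1.

Lemma conj_tupleK g X : g \in unitmx -> conj_tuple g^-1 (conj_tuple g X) = X.
Proof.
move=> gu; apply/funext => i; rewrite /conj_tuple invrK.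
by rewrite !mulrA mulVr// mul1r mulrVK.
Qed.

Lemma conj_tuple_scalar (x : R) X :
  x%:M \in @unitmx R k.+1 -> conj_tuple x%:M X = X.
Proof.
move=> xu; apply/funext => i; rewrite /conj_tuple.
by rewrite (_ : x%:M * X i = X i * x%:M) ?mulrK//; exact/esym/scalar_mxC.
Qed.

Definition normal_form Y :=
  companion_like (Y i0) /\ forall a, a != 0 -> Y i1 a 0 = 0.

(** [g] carries [e_0] to an eigenvector of [Y' i1] with eigenvalue above 1/2, that is to a multiple
    of [e_0]. Since [e_0] is cyclic, [g] is scalar and conjugation by it is trivial. *)
Lemma conj_normal_form_eq Y Y' g : g \in unitmx ->
  normal_form Y -> normal_form Y' ->
  dominant_col0 (Y i1) -> dominant_col0 (Y' i1) ->
  Y' = conj_tuple g Y -> Y' = Y.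
Proof.
move=> gu [cY Y0] [cY' Y'0] dY dY' YE.
have gY i : Y' i * g = g * Y i by rewrite YE /conj_tuple mulrVK.
set y : 'cV_k.+1 := g *m delta_mx 0 0.
have Y1e : Y i1 *m delta_mx 0 0 = Y i1 0 0 *: delta_mx 0 0 :> 'cV_k.+1.
  rewrite -colE; apply/colP => a; rewrite !mxE andbT.
  by have [->|/Y0->] := eqVneq a 0; rewrite ?mulr1 ?mulr0.
have Yy : Y' i1 *m y = Y i1 0 0 *: y.
  by rewrite /y mulmxA [_ *m g]gY -mulmxA Y1e scalemxAr.
have [_ agt _] := dY.
have yE := dominant_eigenvector dY' agt Yy.
(* Column [b] of [g] is [g] applied to [Y i0 ^+ b *m e_0], which is [Y' i0 ^+ b *m y]; hence [g] is
   the Krylov matrix of [y]. *)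
have gE : g = (y 0 0)%:M.
  rewrite -(krylov_companion _ cY') -yE; apply/matrixP => a b.
  have gX n : Y' i0 ^+ n * g = g * Y i0 ^+ n.
    elim: n => [|n IH]; first by rewrite !expr0 mulr1 mul1r.
    by rewrite !exprS -mulrA IH !mulrA gY.
  rewrite mxE /y mulmxA [_ *m g]gX -mulmxA.
  rewrite (companion_likeX cY (ltn_ord b)) -colE mxE.
  by congr (g a _); exact: val_inj.
by rewrite YE gE conj_tuple_scalar// -gE.
Qed.

End NormalForm.

(** * Coordinates on the space of normal forms *)

Section Coordinates.
Variables (R : realType) (k m : nat) (i0 i1 : 'I_m).
Hypothesis i01 : i0 != i1.

Local Notation tuples := (prod_topology (fun _ : 'I_m => 'M[R]_k.+1)).

(** The positions that [normal_form] does not prescribe; their number is the dimension of the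
    quotient. *)
Definition free_entries : pred ('I_m * ('I_k.+1 * 'I_k.+1)) :=
  [pred e | if e.1 == i0 then e.2.2 == ord_max
           else (e.1 == i1) && (e.2.2 == 0) ==> (e.2.1 == 0)].

(** With [N = k.+1]: the companion matrix has N free entries and the entry [i1] has N^2 - (N - 1),
    together N^2 + 1; each of the other m - 2 matrices has N^2. *)
Lemma card_free_entries : #|free_entries| = (m.-1 * k.+1 ^ 2 + 1)%N.
Proof.
have cardE (P : 'I_m -> 'I_k.+1 -> 'I_k.+1 -> bool) :
    #|[pred e : 'I_m * ('I_k.+1 * 'I_k.+1) | P e.1 e.2.1 e.2.2]| =
    (\sum_i \sum_a \sum_b P i a b)%N.
  rewrite pair_big_dep pair_big_dep/= -sum1_card big_mkcond/=.
  rewrite (reindex (fun e : 'I_m * 'I_k.+1 * 'I_k.+1 => (e.1.1, (e.1.2, e.2))))/=.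
    by apply: eq_bigr => -[[i a] b] _; rewrite inE/=; case: (P _ _ _).
  by exists (fun e => (e.1, e.2.1, e.2.2)) => [[[i a] b]|[i [a b]]].
have eqn1 (j : 'I_k.+1) : (\sum_(b < k.+1) (b == j) = 1)%N.
  rewrite (bigD1 j)//= eqxx big1// => b /negbTE ->.
  by [].
rewrite (cardE (fun i a b => if i == i0 then b == ord_max
  else (i == i1) && (b == 0) ==> (a == 0))).
rewrite (bigD1 i0)//= (bigD1 i1)/=; last by rewrite eq_sym.
rewrite eqxx (negbTE (_ : i1 != i0)) 1?eq_sym//= eqxx/=.
under [X in (X + _)%N]eq_bigr do rewrite eqn1.
rewrite sum_nat_const card_ord muln1.
(* Row 0 is entirely free and each of the other k rows loses its entry in column 0. *)
have -> : (\sum_(a < k.+1) \sum_(b < k.+1) ((b == ord0) ==> (a == ord0)) =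
           k * k + k.+1)%N.
  rewrite big_ord_recl/= addnC; congr (_ + _)%N.
    rewrite (eq_bigr (fun=> k)) ?sum_nat_const ?card_ord// => a _.
    rewrite big_ord_recl/= add0n (eq_bigr (fun=> 1%N))//.
    by rewrite sum_nat_const card_ord muln1.
  rewrite (eq_bigr (fun=> 1%N)); last by move=> b _; rewrite implybT.
  by rewrite sum_nat_const card_ord muln1.
rewrite (eq_bigr (fun=> k.+1 * k.+1)%N); last first.
  move=> i /andP[/negbTE -> /negbTE ->] /=.
  by rewrite !sum_nat_const !card_ord muln1.
rewrite sum_nat_const.
have -> : #|[pred i | (i != i0) && (i != i1)]| = m.-2.
  have : (2 + #|[pred i | (i != i0) && (i != i1)]| = m)%N.
    have <- : #|[:: i0; i1]| = 2%N by rewrite (card_uniqP _)//= inE andbT.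
    rewrite -[RHS]card_ord -(cardC (mem [:: i0; i1])); congr (_ + _)%N.
    by apply: eq_card => i; rewrite !inE negb_or.
  by move: #|_| => x; lia.
have : (1 < m)%N.
  case: m i0 i1 i01 => [[]//|[|//]] a b; by rewrite (ord1 a) (ord1 b).
case: m => [|[|p]]// _; rewrite -mulnn /=; nia.
Qed.

(** The inhabitant required by [enum_rank_in]. *)
Lemma free_corner : (i0, (0, ord_max)) \in free_entries.
Proof. by rewrite inE /= eqxx. Qed.

Definition coords (Y : tuples) : 'rV[R]_#|free_entries| :=
  \row_j Y (enum_val j).1 (enum_val j).2.1 (enum_val j).2.2.

(** The default value is the one imposed by a normal form: 1 on the subdiagonal of the companion
    matrix, 0 at the other prescribed positions. *)
Definition of_coords (r : 'rV[R]_#|free_entries|) : tuples := fun i =>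
  \matrix_(a, b) if (i, (a, b)) \in free_entries
                 then r 0 (enum_rank_in free_corner (i, (a, b)))
                 else ((i == i0) && (a == b.+1 :> nat))%:R.

Lemma of_coordsK : cancel of_coords coords.
Proof.
move=> r; apply/rowP => j; rewrite 2!mxE.
have -> : ((enum_val j).1, ((enum_val j).2.1, (enum_val j).2.2)) = enum_val j.
  by case: (enum_val j) => [? []].
by rewrite enum_valP enum_valK_in.
Qed.

Lemma coordsK Y : normal_form i0 i1 Y -> of_coords (coords Y) = Y.
Proof.
move=> [cY Y0]; apply/funext => i; apply/matrixP => a b; rewrite !mxE.
case: ifPn => [eF|]; first by rewrite enum_rankK_in.
rewrite inE /=; case: eqP => [->|_] bk /=.
  rewrite cY// ltn_neqAle -ltnS ltn_ord andbT.
  by apply: contra bk => /eqP bk; apply/eqP/val_inj.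
by move: bk; rewrite negb_imply => /andP[/andP[/eqP-> /eqP->] /Y0 ->].
Qed.

Lemma of_coords_normal r : normal_form i0 i1 (of_coords r).
Proof.
split=> [a b ltbk|a a0]; rewrite !mxE inE /= ?eqxx /=.
  by rewrite -val_eqE/= (ltn_eqF ltbk).
by rewrite eq_sym (negbTE i01) (negbTE a0).
Qed.

Section Continuity.
Variables (T : Type) (F : set_system T).
Hypothesis FF : Filter F.

Lemma cvg_coords (f : T -> tuples) (Y : tuples) :
  f @ F --> Y -> coords (f x) @[x --> F] --> coords Y.
Proof.
move=> fY; apply: cvg_mx => i j; rewrite mxE.
by under eq_cvg => x do rewrite mxE; apply: cvg_mx_entry; exact: cvg_proj.
Qed.

Lemma cvg_of_coords (f : T -> 'rV[R]_#|free_entries|)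
    (r : 'rV[R]_#|free_entries|) :
  f @ F --> r -> of_coords (f x) @[x --> F] --> of_coords r.
Proof.
move=> fr; apply: cvg_prod_topology => i; apply: cvg_mx => a b; rewrite mxE.
under eq_cvg => x do rewrite mxE.
by case: ifP => _; [exact: cvg_mx_entry | exact: cvg_cst].
Qed.

Lemma cvg_conj_tuple (g : T -> 'M[R]_k.+1) (g0 : 'M[R]_k.+1)
    (f : T -> tuples) (Y : tuples) :
  g0 \in unitmx -> g @ F --> g0 -> f @ F --> Y ->
  (conj_tuple (g x) (f x) : tuples) @[x --> F] --> (conj_tuple g0 Y : tuples).
Proof.
move=> g0u gg fY; apply: cvg_prod_topology => i.
apply: cvg_mulmx; last exact: cvg_invmx.
by apply: cvg_mulmx => //; exact: cvg_proj.
Qed.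

Lemma cvg_krylov (A : T -> 'M[R]_k.+1) (A0 : 'M[R]_k.+1)
    (v : T -> 'cV[R]_k.+1) (v0 : 'cV[R]_k.+1) :
  A @ F --> A0 -> v @ F --> v0 -> krylov (A x) (v x) @[x --> F] --> krylov A0 v0.
Proof.
move=> AA vv; apply: cvg_mx => i j; rewrite mxE.
under eq_cvg => x do rewrite mxE.
by apply: cvg_mx_entry; apply: cvg_mulmx => //; exact: cvg_expmx.
Qed.

Lemma cvg_char_mx (A : T -> 'M[R]_k.+1) (A0 : 'M[R]_k.+1)
    (t : T -> R) (t0 : R) :
  A @ F --> A0 -> t @ F --> t0 -> ((t x)%:M - A x) @[x --> F] --> t0%:M - A0.
Proof.
move=> AA tt; apply: cvg_mx => i j; rewrite !mxE.
under eq_cvg => x do rewrite !mxE.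
apply: cvgB; last exact: cvg_mx_entry.
by case: (i == j); rewrite ?mulr1n ?mulr0n; [exact: tt | exact: cvg_cst].
Qed.

End Continuity.

End Coordinates.

(** * The dimension of the space of conjugation classes *)

Section LocalSlice.
Variables (R : realType) (k m : nat) (i0 i1 : 'I_m).
Hypothesis i01 : i0 != i1.

Local Notation tuples := (prod_topology (fun _ : 'I_m => 'M[R]_k.+1)).
Local Notation of_coords := (@of_coords R k m i0 i1).
Local Notation coords := (@coords R k m i0 i1).

(** In the Krylov basis of [v], the entry [i0] is a companion matrix; the first basis vector being
    [v] itself, [e_0] becomes an eigenvector of the entry [i1]. *)
Lemma conj_to_normal_form (Y : tuples) (t : R) (v : 'cV[R]_k.+1) :
  krylov (Y i0) v \in unitmx -> Y i1 *m v = t *: v ->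
  normal_form i0 i1 (conj_tuple (krylov (Y i0) v)^-1 Y).
Proof.
move=> gu Yv; split; rewrite /conj_tuple invrK.
  exact: krylov_conj_companion.
set g := krylov _ _ => a a0.
have -> : (g^-1 * Y i1 * g) a 0 =
    (g^-1 * Y i1 * g *m delta_mx 0 0 : 'cV_k.+1) a 0 by rewrite -colE [RHS]mxE.
rewrite -!mulmxA krylov_col0 Yv -scalemxAr -{1}(krylov_col0 (Y i0) v) mulmxA.
by rewrite mulVmx// mul1mx !mxE (negbTE a0) mulr0.
Qed.

(** This makes the charts open: every tuple near a dominant normal form is conjugate to a normal
    form with coordinates in [B]. A nearby tuple has a real eigenvalue near the dominant one, and
    the corresponding eigenvector provides the conjugating Krylov matrix. *)
Lemma local_slice (r0 : 'rV[R]_#|@free_entries k m i0 i1|)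
    (B : set 'rV[R]_#|@free_entries k m i0 i1|) :
  dominant_col0 (of_coords r0 i1) -> nbhs r0 B ->
  \forall Y \near (of_coords r0 : tuples),
    exists2 r, B r & exists2 g, g \in unitmx & Y = conj_tuple g (of_coords r).
Proof.
move=> dom Br0; set Y0 := of_coords r0; have [cY0 Y00] := of_coords_normal i01 r0.
set t0 := Y0 i1 0 0; set d := cofactor (t0%:M - Y0 i1) 0 0.
have d0 : d != 0 by exact: dominant_cofactor.
pose e0 : 'cV[R]_k.+1 := delta_mx 0 0.
(* The second component of [p] is a candidate eigenvalue; [v p] satisfies the eigenvector equation
   once that candidate is a root of the characteristic polynomial. At [(Y0, t0)] the matrix [g] is
   the scalar [d]. *)
pose v (p : tuples * R) : 'cV_k.+1 := \adj (p.2%:M - p.1 i1) *m e0.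
pose g (p : tuples * R) := krylov (p.1 i0) (v p).
have v0 : v (Y0, t0) = d *: e0 by exact: dominant_adj.
have g0 : g (Y0, t0) = d%:M by rewrite /g v0 krylov_companion.
have g0u : g (Y0, t0) \in unitmx by rewrite g0 unitmxE det_scalar unitrX ?unitfE.
have cfst : (fun p : tuples * R => p.1) @ (Y0, t0) --> Y0 by exact: cvg_fst.
have csnd : (fun p : tuples * R => p.2) @ (Y0, t0) --> t0 by exact: cvg_snd.
have cg : g @ (Y0, t0) --> g (Y0, t0).
  apply: cvg_krylov; first exact: cvg_proj.
  apply: cvg_mulmx; last exact: cvg_cst.
  by apply: cvg_adj; apply: cvg_char_mx => //; exact: cvg_proj.
have cT : coords (conj_tuple (invmx (g p)) p.1) @[p --> (Y0, t0)] --> r0.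
  have conjY0 : conj_tuple (invmx (g (Y0, t0))) Y0 = Y0.
    by rewrite g0 invmx_scalar conj_tuple_scalar// -invmx_scalar unitmx_inv -g0.
  rewrite (_ : r0 = coords (conj_tuple (invmx (g (Y0, t0))) Y0)); last first.
    by rewrite conjY0 of_coordsK.
  apply: cvg_coords; apply: cvg_conj_tuple => //.
    by rewrite unitmx_inv.
  exact: cvg_invmx.
(* For [Y] in [P] and [t] in [Q], [g] is invertible and the coordinates fall in [B]. It remains to
   find a root [t] in [Q]. *)
have := filterI (near_unitmx _ g0u cg) (cT _ Br0).
move=> [[P Q] /= [nP nQ] PQ].
have cd : cofactor (t%:M - Y0 i1) 0 0 * d @[t --> t0] --> d * d.
  apply: cvgM; last exact: cvg_cst.
  have cA : \adj (t%:M - Y0 i1) @[t --> t0] --> \adj (t0%:M - Y0 i1).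
    by apply: cvg_adj; apply: cvg_char_mx; [exact: cvg_cst | exact: cvg_id].
  rewrite (_ : d = (\adj (t0%:M - Y0 i1)) 0 0); last by rewrite mxE.
  rewrite (_ : (fun t => _) = (fun t => (\adj (t%:M - Y0 i1)) 0 0)).
    exact: cvg_mx_entry.
  by apply/funext => t; rewrite mxE.
have dd : 0 < d * d by rewrite -expr2 exprn_even_gt0.
have nD : \forall t \near t0, 0 < cofactor (t%:M - Y0 i1) 0 0 * d.
  exact: cvgr_gt cd _ dd.
have [e /= e_gt0 eQD] := filterI nQ nD.
(* Halving puts the closed interval of radius [e2] inside the open ball of radius [e]. *)
pose e2 := e / 2; have e2_gt0 : 0 < e2 by rewrite divr_gt0.
have e2e : e2 < e by rewrite /e2 ltr_pdivrMr// ltr_pMr// ltr1n.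
have inQ t : `|t - t0| <= e2 -> Q t /\ 0 < cofactor (t%:M - Y0 i1) 0 0 * d.
  move=> tt; apply: eQD => /=; rewrite distrC; exact: le_lt_trans e2e.
(* The factor [d] fixes the sign: at [Y0] this is [t - t0] times a quantity that is positive near
   [t0], so the opposite signs at [t0 - e2] and [t0 + e2] persist for nearby [Y] and give a root by
   the intermediate value theorem. *)
pose f (Y : tuples) t := \det (t%:M - Y i1) * d.
have cf (Y : tuples) : continuous (f Y).
  move=> t; apply: cvgM; last exact: cvg_cst.
  by apply: cvg_det; apply: cvg_char_mx; [exact: cvg_cst | exact: cvg_id].
have FY0 : Filter (nbhs Y0) by exact: nbhs_filter.
have cfY t : f Y t @[Y --> nbhs Y0] --> f Y0 t.
  apply: (@cvgM _ _ _ FY0); last exact: cvg_cst.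
  apply: cvg_det; apply: cvg_char_mx; last exact: cvg_cst.
  by apply: (cvg_proj (f := fun Y : tuples => Y)); exact: cvg_id.
have f0 t : f Y0 t = (t - t0) * (cofactor (t%:M - Y0 i1) 0 0 * d).
  by rewrite /f (char_col0 _ Y00) -mulrA.
have fp : \forall Y \near nbhs Y0, 0 < f Y (t0 + e2).
  apply: cvgr_gt (cfY _) _ _; rewrite f0 addrAC subrr add0r mulr_gt0//.
  by have [] := inQ (t0 + e2) _; rewrite // addrAC subrr add0r gtr0_norm.
have fn : \forall Y \near nbhs Y0, f Y (t0 - e2) < 0.
  apply: cvgr_lt (cfY _) _ _; rewrite f0 addrAC subrr add0r.
  rewrite mulNr oppr_lt0 mulr_gt0//.
  by have [] := inQ (t0 - e2) _; rewrite // addrAC subrr add0r normrN gtr0_norm.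
apply: filterS (filterI nP (filterI fp fn)) => Y [PY [Yp Yn]].
have le12 : t0 - e2 <= t0 + e2 by rewrite lerD2l gt0_cp.
have [] := @IVT R (f Y) _ _ 0 le12.
- exact: continuous_subspaceT.
- by rewrite ge_min le_max (ltW Yp) (ltW Yn) orbT.
move=> t tI /eqP; rewrite mulf_eq0 (negbTE d0) orbF => /eqP det0.
have [Qt _] : Q t /\ 0 < cofactor (t%:M - Y0 i1) 0 0 * d.
  by apply: inQ; rewrite ler_distl; move: tI; rewrite in_itv.
have [gu Br] := PQ (Y, t) (conj PY Qt).
have Yv : Y i1 *m v (Y, t) = t *: v (Y, t).
  apply/eqP; rewrite eq_sym -subr_eq0 -mul_scalar_mx -mulmxBl mulmxA.
  by rewrite mul_mx_adj det0 mul_scalar_mx scale0r.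
have nf := conj_to_normal_form gu Yv.
exists (coords (conj_tuple (invmx (g (Y, t))) Y)) => //.
exists (g (Y, t)) => //.
rewrite (coordsK nf); rewrite -[in RHS](invrK (g (Y, t))) conj_tupleK//.
by rewrite unitmx_inv.
Qed.

End LocalSlice.

(** * Pairs of matrices in general position *)

Section GenericPosition.
Variables (R : realType) (k : nat).

Lemma diag_mxX (S : comNzRingType) (d : 'rV[S]_k.+1) n :
  diag_mx d ^+ n = diag_mx (\row_j d 0 j ^+ n).
Proof.
elim: n => [|n IH].
  rewrite expr0; apply/matrixP => i j; rewrite !mxE expr0.
  by [].
rewrite exprS IH [LHS]mulmx_diag; congr diag_mx; apply/rowP => j.
by rewrite !mxE exprS.
Qed.

(** The reference pair is the diagonal matrix with the distinct eigenvalues 0, ..., k and the matrix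
    of ones; both determinants to be controlled reduce to the Vandermonde matrix [V]. *)
Let lambda : 'rV[R]_k.+1 := \row_j j%:R.
Let ones_col : 'cV[R]_k.+1 := const_mx 1.
Let ones : 'M[R]_k.+1 := const_mx 1.
Let V := Vandermonde k.+1 lambda.

Lemma Vandermonde_nat_unit : V \in unitmx.
Proof.
rewrite unitmxE det_Vandermonde unitfE; apply/prodf_neq0 => i _.
apply/prodf_neq0 => j ltij; rewrite !mxE subr_eq0 eqr_nat.
by rewrite gtn_eqF.
Qed.

Lemma krylov_diag_unit : krylov (diag_mx lambda) ones_col \in unitmx.
Proof.
suff -> : krylov (diag_mx lambda) ones_col = V^T.
  by rewrite unitmx_tr; exact: Vandermonde_nat_unit.
apply/matrixP => i j; rewrite mxE diag_mxX mul_diag_mx !mxE mulr1.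
by [].
Qed.

(** For this pair the word sum of [c] is [V^T *m c *m V], from which [c] is recovered by inverting
    [V]. *)
Lemma word_mx_diag_unit : word_mx (diag_mx lambda) ones \in unitmx.
Proof.
have wordE c : word_sum (diag_mx lambda) ones c = V^T *m c *m V.
  apply/matrixP => a b; rewrite mxE; under [RHS]eq_bigr do rewrite mxE mulr_suml.
  rewrite exchange_big/= /word_sum summxE; apply: eq_bigr => i _.
  rewrite summxE; apply: eq_bigr => j _.
  rewrite !diag_mxX mxE [X in _ * X](_ : _ = lambda 0 a ^+ i * lambda 0 b ^+ j).
    by rewrite !mxE mulrA [c i j * _]mulrC.
  by rewrite [_ * _]mul_mx_diag mxE [_ * ones]mul_diag_mx !mxE mulr1.
rewrite -row_free_unit; apply: inj_row_free => v.
rewrite -[v]vec_mxK mul_vec_lin /= wordE => /(congr1 vec_mx).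
rewrite mxvecK linear0 => e; rewrite -[vec_mx v](mulKmx (_ : V^T \in unitmx)).
  rewrite -[_ *m vec_mx v](mulmxK Vandermonde_nat_unit) e mul0mx mulmx0.
  by rewrite linear0.
by rewrite unitmx_tr Vandermonde_nat_unit.
Qed.

(** Both conclusions say that a determinant polynomial in [t] does not vanish, so [p] is the product
    of the two determinants. *)
Lemma generic_line (A B : 'M[R]_k.+1) :
  exists A' B' : 'M[R]_k.+1, exists v : 'cV[R]_k.+1, exists2 p : {poly R}, p != 0 &
    forall t, p.[t] != 0 ->
      krylov (A + t *: A') v \in unitmx /\
      word_mx (A + t *: A') (B + t *: B') \in unitmx.
Proof.
(* At [t = 1] the line reaches the reference pair, hence neither determinant is the zero
   polynomial. *)
pose A' := diag_mx lambda - A; pose B' := ones - B.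
pose lineX (M M' : 'M[R]_k.+1) : 'M[{poly R}]_k.+1 :=
  map_mx polyC M + 'X *: map_mx polyC M'.
pose pK := \det (krylov (lineX A A') (map_mx polyC ones_col)).
pose pW := \det (word_mx (lineX A A') (lineX B B')).
have lineE t (M M' : 'M[R]_k.+1) :
    map_mx (horner_eval t) (lineX M M') = M + t *: M'.
  apply/matrixP => i j; rewrite !mxE /horner_eval.
  by rewrite hornerD hornerM hornerX !hornerC.
have pKE t : pK.[t] = \det (krylov (A + t *: A') ones_col).
  rewrite -lineE -[LHS]/(horner_eval t pK) -det_map_mx map_krylov.
  congr (\det (krylov _ _)).
  by apply/matrixP => i j; rewrite !mxE /= /horner_eval hornerC.
have pWE t : pW.[t] = \det (word_mx (A + t *: A') (B + t *: B')).
  by rewrite -!lineE -[LHS]/(horner_eval t pW) -det_map_mx map_word_mx.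
exists A', B', ones_col, (pK * pW).
  apply/eqP => /(congr1 (horner_eval 1)); rewrite /horner_eval hornerM horner0.
  rewrite pKE pWE !scale1r /A' /B' !(addrC _ (_ - _)) !subrK.
  apply/eqP; rewrite mulf_neq0// -unitfE -unitmxE.
    exact: krylov_diag_unit.
  exact: word_mx_diag_unit.
by move=> t; rewrite hornerM pKE pWE mulf_eq0 negb_or -!unitfE -!unitmxE => /andP[].
Qed.

(** The [size p] distinct points e/2, e/3, ... of the interval are too many to be all roots of
    [p]. *)
Lemma poly_small_nonroot (p : {poly R}) (e : R) : p != 0 -> 0 < e ->
  exists2 t, `|t| < e & p.[t] != 0.
Proof.
move=> p0 e0; pose s := [seq e / i.+2%:R | i <- iota 0 (size p)].
have us : uniq s.
  rewrite map_inj_uniq ?iota_uniq// => i j.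
  move=> /(mulfI (lt0r_neq0 e0))/invr_inj/eqP.
  by rewrite eqr_nat => /eqP[].
have : ~~ all (root p) s.
  apply/negP => /(max_poly_roots p0)/(_ us).
  by rewrite size_map size_iota ltnn.
rewrite -has_predC => /hasP[t /mapP[i _ ->]] /= ir.
exists (e / i.+2%:R) => //.
by rewrite gtr0_norm ?divr_gt0// ltr_pdivrMr// ltr_pMr// ltr1n.
Qed.

End GenericPosition.

(** * Sheared normal forms *)

Section Charts.
Variables (R : realType) (k m : nat) (i0 i1 i2 : 'I_m).
Hypotheses (i01 : i0 != i1) (i12 : i1 != i2) (i02 : i0 != i2).

Local Notation tuples := (prod_topology (fun _ : 'I_m => 'M[R]_k.+1)).
Local Notation of_coords := (@of_coords R k m i0 i1).
Local Notation coords := (@coords R k m i0 i1).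
Local Notation d := #|@free_entries k m i0 i1|.

(* A triangular automorphism of the space of tuples: [c] can be chosen so as to
   give the entry [i1] any prescribed value at one given generic tuple. *)
Definition shear (c : 'M[R]_k.+1) (X : tuples) : tuples := fun i =>
  if i == i1 then X i1 + word_sum (X i0) (X i2) c else X i.

(** The added word sum involves only the entries [i0] and [i2], which a shear leaves fixed. *)
Lemma shearK c : cancel (shear c) (shear (- c)).
Proof.
move=> X; apply/funext => i; rewrite /shear (negbTE i01).
rewrite [i2 == i1]eq_sym (negbTE i12) eqxx.
by case: eqP => // ->; rewrite linearN/= addrK.
Qed.

Lemma shearNK c : cancel (shear (- c)) (shear c).
Proof. by move=> X; rewrite -{1}[c]opprK shearK. Qed.

Lemma shear_conj c g X : g \in unitmx ->
  shear c (conj_tuple g X) = conj_tuple g (shear c X).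
Proof.
move=> gu; apply/funext => i; rewrite /shear /conj_tuple word_sum_conj//.
by case: ifP => // _; rewrite mulrDr mulrDl.
Qed.

Lemma cvg_shear (T : Type) (F : set_system T) (FF : Filter F)
    (f : T -> tuples) (X : tuples) c :
  f @ F --> X -> shear c (f x) @[x --> F] --> shear c X.
Proof.
move=> fX; apply: cvg_prod_topology => i; rewrite /shear.
case: ifP => _; last exact: cvg_proj.
apply: cvgD; first exact: cvg_proj.
apply: cvg_big => [|a _]; first by move=> x; exact: add_continuous.
apply: cvg_big => [|b _]; first by move=> x; exact: add_continuous.
apply: cvgZ; first exact: cvg_cst.
apply: cvg_mulmx; last by apply: cvg_expmx; exact: cvg_proj.
by apply: cvg_mulmx; [apply: cvg_expmx|]; exact: cvg_proj.
Qed.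

(** The sign is chosen so that [shear c] brings a chart tuple back to its normal form. *)
Definition chart_tuple c (r : 'rV[R]_d) : tuples := shear (- c) (of_coords r).

Definition chart_domain c : set 'rV[R]_d :=
  [set r | (forall i, chart_tuple c r i \in unitmx) /\
           dominant_col0 (of_coords r i1)].

Lemma cvg_chart_tuple c (r : 'rV[R]_d) :
  chart_tuple c s @[s --> nbhs r] --> chart_tuple c r.
Proof.
have FF : Filter (nbhs r) by exact: nbhs_filter.
by apply: (cvg_shear FF); apply: (cvg_of_coords FF); exact: cvg_id.
Qed.

(** The only closed condition, the vanishing of column 0 below the corner, holds for every
    [of_coords r]; the others are strict inequalities and invertibility. *)
Lemma chart_domain_open c : open (chart_domain c).
Proof.
rewrite openE => r [ru [Y0 agt Dlt]].
have FF : Filter (nbhs r) by exact: nbhs_filter.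
have cr : of_coords s @[s --> nbhs r] --> of_coords r.
  by apply: (cvg_of_coords FF); exact: cvg_id.
have cr1 : of_coords s i1 @[s --> nbhs r] --> of_coords r i1 by exact: cvg_proj.
have U : \forall s \near nbhs r, forall i, chart_tuple c s i \in unitmx.
  apply: filter_forall => i; apply: (near_unitmx FF (ru i)).
  by apply: cvg_proj; exact: cvg_chart_tuple.
have gtU : \forall s \near nbhs r, 2^-1 < of_coords s i1 0 0.
  have := cvg_mx_entry (i := 0) (j := 0) cr1.
  by move=> /(@cvgr_gt R _ _ FF _ _); apply.
have ltU : \forall s \near nbhs r,
    \sum_i \sum_j `|row' 0 (col' 0 (of_coords s i1)) i j| < 2^-1.
  apply: (@cvgr_lt R _ _ FF _ _ _ _ Dlt).
  apply: cvg_big => [|a _]; first by move=> x; exact: add_continuous.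
  apply: cvg_big => [|b _]; first by move=> x; exact: add_continuous.
  apply: cvg_norm; rewrite 2!mxE; under eq_cvg => x do rewrite 2!mxE.
  exact: (cvg_mx_entry (i := lift 0 a) (j := lift 0 b) cr1).
apply: filterS (filterI U (filterI gtU ltU)) => s [su [sgt slt]].
by split=> //; split => //; case: (of_coords_normal i01 s).
Qed.

Lemma chart_tuple_inj c r s g : chart_domain c r -> chart_domain c s ->
  g \in unitmx -> chart_tuple c s = conj_tuple g (chart_tuple c r) -> s = r.
Proof.
move=> [_ dr] [_ ds] gu /(congr1 (shear c)).
rewrite shear_conj// !shearNK => e.
apply: (can_inj (@of_coordsK R k m i0 i1)).
by apply: (conj_normal_form_eq gu _ _ dr ds e); exact: of_coords_normal.
Qed.

(** [local_slice] transported by the shear, which is continuous and commutes with conjugation. *)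
Lemma chart_tuple_slice c r B : chart_domain c r -> nbhs r B ->
  \forall X \near (chart_tuple c r : tuples),
    exists2 s, B s & exists2 g, g \in unitmx & X = conj_tuple g (chart_tuple c s).
Proof.
move=> [_ dr] Br.
have cs : shear c X @[X --> nbhs (chart_tuple c r)] --> of_coords r.
  by rewrite -[of_coords r](shearNK c); exact: (cvg_shear (nbhs_filter _) cvg_id).
apply: (@filterS _ _ (nbhs_filter _) _ _ _ (cs _ (local_slice i01 dr Br))).
move=> X [s Bs [g gu XE]].
exists s => //; exists g => //.
by rewrite /chart_tuple -shear_conj// -XE shearK.
Qed.

(** A small move of the entries [i0] and [i2] makes the pair generic; a suitable shear then gives
    the entry [i1] a dominant eigenvector that is cyclic for the entry [i0]. *)
Lemma chart_tuple_dense (X : tuples) (A : set tuples) :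
  (forall i, X i \in unitmx) -> nbhs X A ->
  exists c, exists2 r, chart_domain c r &
    exists2 g, g \in unitmx & A (conj_tuple g (chart_tuple c r)).
Proof.
move=> Xu AX.
have [A' [B' [v [p p0 pP]]]] := generic_line (X i0) (X i2).
pose D i := if i == i0 then A' else if i == i2 then B' else 0.
pose line (t : R) : tuples := fun i => X i + t *: D i.
have cline : line t @[t --> (0 : R)] --> X.
  apply: cvg_prod_topology => i.
  rewrite -[X i in X in _ --> X]addr0 -(scale0r (D i)).
  by apply: cvgD; [exact: cvg_cst | apply: cvgZ; [exact: cvg_id | exact: cvg_cst]].
have U : \forall t \near nbhs (0 : R), forall i, line t i \in unitmx.
  apply: (@filter_forall R 'I_m (fun i t => line t i \in unitmx)) => i.
  exact: (near_unitmx (nbhs_filter _) (Xu i) (cvg_proj cline)).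
have AL : \forall t \near nbhs (0 : R), A (line t) by exact: cline.
have [e /= e0 eAU] := filterI AL U.
have [t te pt] := poly_small_nonroot p0 e0.
have [At tu] : A (line t) /\ forall i, line t i \in unitmx.
  by apply: eAU; rewrite /= sub0r normrN.
have [] := pP t pt; set Z := line t.
have -> : X i0 + t *: A' = Z i0 by rewrite /Z /line /D eqxx.
have -> : X i2 + t *: B' = Z i2.
  by rewrite /Z /line /D eqxx eq_sym (negbTE i02).
set g := krylov _ v => gu Wu.
(* The prescribed value of the sheared entry [i1] is the rank one projector which becomes
   [delta_mx 0 0] in the basis [g]: eigenvalue 1 on [e_0], and a zero small block. *)
have [c cE] := word_sum_surj (g * delta_mx 0 0 * g^-1 - Z i1) Wu.
have giu : g^-1 \in unitmx by rewrite unitmx_inv.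
pose Y : tuples := conj_tuple g^-1 Z.
have Y1 : shear c Y i1 = delta_mx 0 0.
  rewrite /Y shear_conj// /conj_tuple /shear eqxx cE addrC subrK invrK.
  by rewrite !mulrA mulVr// mul1r mulrVK.
have nf : normal_form i0 i1 (shear c Y).
  split; last by move=> a a0; rewrite Y1 mxE (negbTE a0).
  rewrite /shear (negbTE i01) /Y /conj_tuple invrK.
  exact: krylov_conj_companion.
have rE : of_coords (coords (shear c Y)) = shear c Y by exact: coordsK.
have chE : chart_tuple c (coords (shear c Y)) = Y.
  by rewrite /chart_tuple rE shearK.
exists c, (coords (shear c Y)).
  split.
    move=> i; rewrite chE /Y /conj_tuple invrK.
    by rewrite [_ * _]/(_ *m _) unitmx_mul gu [_ * _]/(_ *m _) unitmx_mul giu (tu i).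
  rewrite rE Y1; split; rewrite ?mxE.
  - by move=> a a0; rewrite mxE (negbTE a0).
  - by rewrite eqxx invf_lt1// ltr1n.
  - rewrite big1 ?invr_gt0// => i _; rewrite big1// => j _.
    by rewrite !mxE normr0.
exists g => //; rewrite chE /Y -{1}[g]invrK conj_tupleK//.
Qed.

End Charts.

(** * Charts on the quotient by conjugation *)

Section ConjugationDimension.
Variables (R : realType) (k m : nat) (i0 i1 i2 : 'I_m).
Hypotheses (i01 : i0 != i1) (i12 : i1 != i2) (i02 : i0 != i2).

Local Notation tuples := (prod_topology (fun _ : 'I_m => 'M[R]_k.+1)).
Local Notation GLm := (GL_tuples R m k.+1).
Local Notation Q := (quotient_topology {eq_quot (@conj_equiv_rel R m k.+1)}).
Local Notation d := #|@free_entries k m i0 i1|.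

Lemma pi_conjP (X Y : GLm) :
  \pi_Q X = \pi_Q Y <->
  exists2 g, g \in unitmx & (val Y : tuples) = conj_tuple g (val X).
Proof.
split.
  by move=> /eqmodP/asboolP[g gu e]; exists g => //; apply/funext => i; exact: e.
move=> [g gu e]; apply/eqmodP/asboolP; exists g => // i.
by rewrite e.
Qed.

Lemma one_tuple_unit : @GL_tuples_set R m k.+1 (fun=> 1%:M).
Proof. by move=> i; exact: unitmx1. Qed.

(** A total map, so that [chart] is defined on the whole coordinate space; the default tuple of
    identities never occurs on a chart domain. *)
Definition to_GL (X : tuples) : GLm :=
  if pselect (@GL_tuples_set R m k.+1 X) is left Xu
  then exist _ X (mem_set Xu) else exist _ (fun=> 1%:M) (mem_set one_tuple_unit).

Lemma to_GLK X : (forall i, X i \in unitmx) -> val (to_GL X) = X.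
Proof. by rewrite /to_GL; case: pselect. Qed.

Lemma GL_tuple_unit (X : GLm) i : (val X : tuples) i \in unitmx.
Proof. by have := set_mem (valP X); apply. Qed.

Definition chart c (r : 'rV[R]_d) : Q := \pi_Q (to_GL (chart_tuple i2 c r)).

Local Notation dom c := (@chart_domain R k m i0 i1 i2 c).

Lemma val_to_GL_chart c r : dom c r ->
  val (to_GL (chart_tuple i2 c r)) = chart_tuple i2 c r.
Proof. by case=> ru _; exact: to_GLK. Qed.

Lemma chart_inj c r s : dom c r -> dom c s -> chart c r = chart c s -> r = s.
Proof.
move=> dr ds /esym/pi_conjP[g gu]; rewrite !val_to_GL_chart// => e.
exact: (chart_tuple_inj i01 i12 ds dr gu e).
Qed.

(** Openness is tested on the preimage in the space of tuples. Conjugation by a fixed [g^-1] moves a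
    neighbourhood of [X] next to a chart tuple, where [chart_tuple_slice] applies. *)
Lemma chart_open c B : open B -> B `<=` dom c -> open (chart c @` B).
Proof.
move=> oB Bd; rewrite /open/= /quotient_open openE => X [r Br rX].
have [g gu XE] := (pi_conjP _ _).1 rX.
rewrite (val_to_GL_chart (Bd _ Br)) in XE.
have giu : g^-1 \in unitmx by rewrite unitmx_inv.
have Fv : (conj_tuple g^-1 (val Y) : tuples) @[Y --> nbhs X] -->
          (chart_tuple i2 c r : tuples).
  rewrite -[chart_tuple _ _ _](conj_tupleK _ gu) -XE.
  apply: cvg_conj_tuple => //; first exact: cvg_cst.
  exact: initial_continuous.
have nB : nbhs r B by exact: open_nbhs_nbhs.
apply: (@filterS _ _ (nbhs_filter _) _ _ _
  (Fv _ (chart_tuple_slice i01 i12 (Bd _ Br) nB))).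
move=> Y [s Bs [h hu YE]]; exists s => //.
apply/pi_conjP; exists (g * h).
  by rewrite [_ * _]/(_ *m _) unitmx_mul gu.
rewrite (val_to_GL_chart (Bd _ Bs)) -[LHS](conj_tupleK _ giu) invrK YE.
apply/funext => i; rewrite /conj_tuple invrM// !mulrA.
by [].
Qed.

Lemma chart_continuous c A : open A -> open (dom c `&` chart c @^-1` A).
Proof.
move=> oA; rewrite openE => r [dr Ar].
have FF : Filter (nbhs r) by exact: nbhs_filter.
have dn : nbhs r (dom c).
  by apply: open_nbhs_nbhs; split => //; exact: chart_domain_open.
apply: filterI => //; have cont : chart c @ nbhs r --> chart c r.
  apply: (@continuous_cvg _ _ _ (nbhs r) _ (fun s => to_GL (chart_tuple i2 c s))
    (\pi_Q : GLm -> Q)).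
    exact: pi_continuous.
  apply: cvg_set_type; rewrite val_to_GL_chart//.
  apply: (@cvg_trans _ (chart_tuple i2 c @ nbhs r)).
    apply: near_eq_cvg; apply: filterS dn => s ds.
    by rewrite val_to_GL_chart.
  exact: cvg_chart_tuple.
exact: (cont _ (open_nbhs_nbhs (conj oA Ar))).
Qed.

Lemma has_dim_GL_tuples_mod_Ad :
  has_dim R (GL_tuples_mod_Ad R m k.+1) #|@free_entries k m i0 i1|.
Proof.
(* The shear depends on the tuple to be approached, so the dense locus is the union of the chart
   images over all [c]. *)
have dense_charts : dense (\bigcup_c (chart c @` dom c)).
  move=> A [q Aq] oA; have oA' : open (\pi_Q @^-1` A) by exact: oA.
  have [W oW WA] := oA'.
  have XW : W (val (repr q)).
    by rewrite -[W _]/((val @^-1` W) (repr q)) WA /= reprK.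
  have [c [r dr [g gu Wr]]] := chart_tuple_dense i01 i12 i02
    (GL_tuple_unit (repr q)) (open_nbhs_nbhs (conj oW XW)).
  have Zu i : conj_tuple g (chart_tuple i2 c r) i \in unitmx.
    have [ru _] := dr.
    rewrite /conj_tuple [_ * _]/(_ *m _) unitmx_mul unitmx_inv gu andbT.
    by rewrite [_ * _]/(_ *m _) unitmx_mul gu ru.
  exists (\pi_Q (to_GL (conj_tuple g (chart_tuple i2 c r)))); split.
    rewrite -[A _]/((\pi_Q @^-1` A) _) -WA.
    by rewrite -[_ (to_GL _)]/(W (val (to_GL _))) to_GLK.
  exists c => //; exists r => //; apply/pi_conjP; exists g => //.
  by rewrite to_GLK// val_to_GL_chart.
exists (\bigcup_c (chart c @` dom c)); split => //.
- apply: bigcup_open => c _; apply: chart_open => //.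
  exact: chart_domain_open.
- have [x [_ Ux]] := dense_charts setT
    (ex_intro _ (\pi_Q (to_GL (fun=> 1%:M))) I) openT.
  by exists x.
- move=> x [c _ cx].
  apply: (@locally_euclidean_param R _ _ _ (dom c) (chart c)) => //.
  + exact: chart_domain_open.
  + exact: chart_inj.
  + exact: chart_open.
  + exact: chart_continuous.
  + by move=> y cy; exists c.
Qed.

End ConjugationDimension.

(** * Coordinates of twisted lifts *)

Section Frames.
Variables (R : realType) (N : nat).
Implicit Types (u v : nat -> 'M[R]_(N + N + N, N)) (x y z : 'M[R]_N).

Definition frame u k : 'M[R]_(N + N + N) :=
  row_mx (row_mx (u k) (u k.+1)) (u k.+2).

Definition tri_col x y z : 'M[R]_(N + N + N, N) := col_mx (col_mx x y) z.

Lemma frame_tri u k x y z :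
  frame u k *m tri_col x y z = u k *m x + u k.+1 *m y + u k.+2 *m z.
Proof. by rewrite !mul_row_col. Qed.

Lemma frame_inj u k x y z x' y' z' : frame u k \in unitmx ->
  u k *m x + u k.+1 *m y + u k.+2 *m z =
  u k *m x' + u k.+1 *m y' + u k.+2 *m z' -> [/\ x = x', y = y' & z = z'].
Proof.
move=> fu; rewrite -!frame_tri => /(can_inj (mulKmx fu)).
by move=> /eq_col_mx[/eq_col_mx[-> ->] ->].
Qed.

Lemma unitmx_span p (B B' L : 'M[R]_p) :
  B = B' *m L -> B \in unitmx -> B' \in unitmx.
Proof.
move=> BE Bu; have : B' *m (L *m invmx B) = 1%:M by rewrite mulmxA -BE mulmxV.
by move=> /mulmx1_unit[].
Qed.

(** A square matrix whose column space contains that of an invertible frame is invertible; only the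
    coordinates [L0], [L1], [L2] have to be exhibited. *)
Lemma frame_unit_cols (B : 'M[R]_(N + N + N)) u k (L0 L1 L2 : 'M[R]_(N + N + N, N)) :
  u k = B *m L0 -> u k.+1 = B *m L1 -> u k.+2 = B *m L2 ->
  frame u k \in unitmx -> B \in unitmx.
Proof.
move=> e0 e1 e2; apply: unitmx_span; rewrite /frame e0 e1 e2.
by rewrite -!mul_mx_row.
Qed.

Lemma frame_gauge u v (p : nat -> 'M[R]_N) k : (forall j, p j \in unitmx) ->
  (forall j, u j = v j *m p j) -> frame v k \in unitmx -> frame u k \in unitmx.
Proof.
move=> pu uE.
have vE j : v j = u j *m invmx (p j) by rewrite uE mulmxK.
apply: (@frame_unit_cols _ _ _ (tri_col (invmx (p k)) 0 0)
  (tri_col 0 (invmx (p k.+1)) 0) (tri_col 0 0 (invmx (p k.+2)))).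
- by rewrite frame_tri !mulmx0 !addr0.
- by rewrite frame_tri !mulmx0 addr0 add0r.
- by rewrite frame_tri !mulmx0 !add0r.
Qed.

End Frames.

(** * Twisted lifts as sequences indexed by natural numbers *)

Section LiftSequence.
Variables (R : realType) (n N : nat).
Hypothesis n_gt0 : (0 < n)%N.

Definition ord_modn k : 'I_n := Ordinal (ltn_pmod k n_gt0).

(** Index [k] stands for V_(k+1), extended beyond the first period by the monodromy. *)
Definition lift_seq (w : lift_space R n N) k : 'M[R]_(N + N + N, N) :=
  w.2 ^+ (k %/ n) *m w.1 (ord_modn k).

Lemma lift_seqDn w k : lift_seq w (k + n) = w.2 *m lift_seq w k.
Proof.
rewrite /lift_seq divnDr// divnn n_gt0 addn1 exprS -!mulmxA.
by congr (_ *m (_ *m w.1 _)); apply: val_inj; rewrite /= modnDr.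
Qed.

Lemma lift_seq_ord w (i : 'I_n) : lift_seq w i = w.1 i.
Proof.
rewrite /lift_seq divn_small// expr0 mul1mx; congr (w.1 _).
by apply: val_inj; rewrite /= modn_small.
Qed.

Lemma periodic_uniq (u v : nat -> 'M[R]_(N + N + N, N)) (M : 'M[R]_(N + N + N)) :
  (forall k, u (k + n)%N = M *m u k) -> (forall k, v (k + n)%N = M *m v k) ->
  (forall i : 'I_n, u i = v i) -> u =1 v.
Proof.
move=> uM vM uv k; rewrite (divn_eq k n) (addnC (k %/ n * n)%N).
elim: (k %/ n)%N => [|q IH].
  by rewrite mul0n addn0; exact: (uv (ord_modn k)).
by rewrite mulSnr (addnA (k %% n)%N) uM vM IH.
Qed.

Definition coeffs_exist (v : nat -> 'M[R]_(N + N + N, N)) k :=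
  exists A B C : 'M[R]_N,
    [/\ A \in unitmx, B \in unitmx, C \in unitmx &
        v k.+3 = v k *m A + v k.+1 *m B + v k.+2 *m C].

(** A twisted lift is determined by its terms of positive index, and nondegeneracy propagates to all
    integers because the monodromy is invertible. *)
Lemma TL_setP w : TL_set w <->
  w.2 \in unitmx /\
  (forall k, frame (lift_seq w) k \in unitmx /\ coeffs_exist (lift_seq w) k).
Proof.
split=> [[V [_ Mu VM nd] wV]|[Mu nd]].
  split => //.
  have VE k : lift_seq w k = V (k.+1)%:Z.
    apply: (periodic_uniq (M := w.2) (v := fun k => V (k.+1)%:Z)) => [j|j|i].
    - exact: lift_seqDn.
    - by rewrite -VM; congr V; lia.
    - by rewrite lift_seq_ord wV.
  move=> k; have [fu [A [B [C [Au Bu Cu e]]]]] := nd (k.+1)%:Z.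
  have i1 : (k.+1)%:Z + 1 = (k.+2)%:Z by lia.
  have i2 : (k.+1)%:Z + 2 = (k.+3)%:Z by lia.
  have i3 : (k.+1)%:Z + 3 = (k.+4)%:Z by lia.
  split; first by move: fu; rewrite /block3 i1 i2 /frame !VE.
  by exists A, B, C; split => //; rewrite !VE -i3 e i1 i2.
(* To reach negative indices, move [K] periods forward and come back by the inverse monodromy; the
   result does not depend on [K] once the shifted index is nonnegative. *)
pose E (i : int) K := invmx w.2 ^+ K *m lift_seq w (absz (i - 1 + (n * K)%:Z)%R).
have ES i K : 0 <= i - 1 + (n * K)%:Z -> E i K.+1 = E i K.
  move=> iK; rewrite /E exprSr -mulmxA; congr (_ *m _).
  have -> : absz (i - 1 + (n * K.+1)%:Z) = (absz (i - 1 + (n * K)%:Z)%R + n)%N.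
    by rewrite mulnS; lia.
  by rewrite lift_seqDn mulKmx.
have ED i K t : 0 <= i - 1 + (n * K)%:Z -> E i (K + t)%N = E i K.
  move=> iK; elim: t => [|t IH]; first by rewrite addn0.
  by rewrite addnS ES ?IH// mulnDr; lia.
have EE i K K' : 0 <= i - 1 + (n * K)%:Z -> 0 <= i - 1 + (n * K')%:Z ->
    E i K = E i K'.
  by move=> iK iK'; rewrite -(ED i K K')// (addnC K) ED.
pose V i := E i (absz (i - 1)%R).
have Vok (i : int) : 0 <= i - 1 + (n * (absz (i - 1)%R))%:Z.
  have : ((absz (i - 1)%R) <= n * (absz (i - 1)%R))%N by rewrite leq_pmull.
  by move: (n * _)%N => x; lia.
have VE i K : 0 <= i - 1 + (n * K)%:Z -> V i = E i K.
  by move=> iK; apply: EE.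
(* The same number of periods serves [i] and all later indices, so the terms of one recurrence are
   images of consecutive terms of [lift_seq] under a single invertible matrix. *)
have VDn i j : V (i + j%:Z) =
    invmx w.2 ^+ (absz (i - 1)%R) *m
    lift_seq w (j + absz (i - 1 + (n * absz (i - 1)%R)%:Z)%R).
  have ok := Vok i; rewrite (VE _ (absz (i - 1)%R)); last by lia.
  by rewrite /E; congr (_ *m lift_seq w _); lia.
exists V; last first.
  move=> i; rewrite (VE _ 0%N); last by lia.
  rewrite /E expr0 mul1mx -lift_seq_ord; congr (lift_seq w _); lia.
have nondeg : Defs.nondegenerate V.
  move=> i; set q := invmx w.2 ^+ (absz (i - 1)%R).
  have qu : q \in unitmx.
    rewrite /q; elim: (absz (i - 1)%R) => [|t IH]; first exact: unitmx1.
    by rewrite exprS [_ * _]/(_ *m _) unitmx_mul unitmx_inv Mu.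
  set a := absz (i - 1 + (n * absz (i - 1)%R)%:Z)%R.
  have V0 : V i = q *m lift_seq w a by rewrite -[i in LHS]addr0 (VDn i 0%N).
  have V1 : V (i + 1) = q *m lift_seq w a.+1 by rewrite (VDn i 1%N).
  have V2 : V (i + 2) = q *m lift_seq w a.+2 by rewrite (VDn i 2%N).
  have V3 : V (i + 3) = q *m lift_seq w a.+3 by rewrite (VDn i 3%N).
  have [fu [A [B [C [Au Bu Cu e]]]]] := nd a; split.
    by rewrite /block3 V0 V1 V2 -!mul_mx_row unitmx_mul qu.
  by exists A, B, C; split => //; rewrite V0 V1 V2 V3 e !mulmxDr !mulmxA.
split => //.
- move=> i; have [fu _] := nondeg i; apply/eqP; rewrite eqn_leq rank_leq_col /=.
  (* The first block row of the inverse of the frame is a left inverse of [V i]. *)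
  apply: (@mulmx1_min_rank _ _ _ _ _
    (row_mx (row_mx 1%:M 0) 0 *m invmx (block3 V i)) 1%:M).
  rewrite mulmx1 -mulmxA.
  have -> : V i = block3 V i *m tri_col 1%:M 0 0.
    by rewrite /block3 !mul_row_col mulmx1 !mulmx0 !addr0.
  by rewrite mulKmx// !mul_row_col !mul0mx !addr0 mulmx1.
- move=> i; rewrite (VDn i n).
  rewrite (addnC n) lift_seqDn -[i in RHS]addr0 (VDn i 0%N) add0n.
  move: (lift_seq w _) => z; elim: (absz _) => [|q IH]; first by rewrite !mul1mx.
  by rewrite exprS -!mulmxA IH !mulmxA mulVmx// mulmxV.
Qed.

End LiftSequence.

(** * Normalized lifts and their tuples of invariants *)

Section NormalizedLifts.
Variables (R : realType) (n N : nat).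
Hypothesis n_gt0 : (0 < n)%N.

Local Notation tuples := (prod_topology (fun _ : 'I_(2 * n + 1) => 'M[R]_N)).
Local Notation lift_seq := (@lift_seq R n N n_gt0).
Implicit Types (X Y : tuples) (w : lift_space R n N).

(** Layout of a tuple: the n coefficients A, then the n coefficients B, then the holonomy. *)
Lemma idxA_subproof k : (k %% n < 2 * n + 1)%N.
Proof. by have := ltn_pmod k n_gt0; lia. Qed.
Lemma idxB_subproof k : (n + k %% n < 2 * n + 1)%N.
Proof. by have := ltn_pmod k n_gt0; lia. Qed.
Lemma idxP_subproof : (2 * n < 2 * n + 1)%N.
Proof. lia. Qed.

Definition hol X : 'M[R]_N := X (Ordinal idxP_subproof).
Definition coefA X k : 'M[R]_N :=
  hol X ^+ (k %/ n) *m X (Ordinal (idxA_subproof k)) *m invmx (hol X) ^+ (k %/ n).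
Definition coefB X k : 'M[R]_N :=
  hol X ^+ (k %/ n) *m X (Ordinal (idxB_subproof k)) *m invmx (hol X) ^+ (k %/ n).

Definition tuple_of (a b : nat -> 'M[R]_N) (P : 'M[R]_N) : tuples := fun i =>
  if (i < n)%N then a i else if (i < 2 * n)%N then b (i - n)%N else P.

Lemma tuples_eq X Y : hol X = hol Y ->
  (forall k, (k < n)%N ->
    X (Ordinal (idxA_subproof k)) = Y (Ordinal (idxA_subproof k))) ->
  (forall k, (k < n)%N ->
    X (Ordinal (idxB_subproof k)) = Y (Ordinal (idxB_subproof k))) ->
  X = Y.
Proof.
move=> eP eA eB; apply/funext => i.
have [lt_in|le_ni] := ltnP i n.
  have -> : i = Ordinal (idxA_subproof i) by apply: val_inj; rewrite /= modn_small.
  exact: eA.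
have [lt_i2n|le_2ni] := ltnP i (2 * n).
  have ltn_in : (i - n < n)%N by lia.
  have -> : i = Ordinal (idxB_subproof (i - n)).
    by apply: val_inj; rewrite /= modn_small// subnKC.
  exact: eB.
have -> : i = Ordinal idxP_subproof by apply: val_inj => /=; have := ltn_ord i; lia.
exact: eP.
Qed.

Lemma coefA_small X k : (k < n)%N -> coefA X k = X (Ordinal (idxA_subproof k)).
Proof. by move=> kn; rewrite /coefA divn_small// !expr0 mul1mx mulmx1. Qed.

Lemma coefB_small X k : (k < n)%N -> coefB X k = X (Ordinal (idxB_subproof k)).
Proof. by move=> kn; rewrite /coefB divn_small// !expr0 mul1mx mulmx1. Qed.

Lemma coefADn X k : coefA X (k + n) = hol X *m coefA X k *m invmx (hol X).
Proof.
rewrite /coefA (_ : ((k + n) %/ n)%N = (k %/ n).+1).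
  rewrite exprS exprSr -!mulmxA.
  by congr (_ *m (_ *m (X _ *m _))); apply: val_inj; rewrite /= modnDr.
by rewrite divnDr// divnn n_gt0 addn1.
Qed.

Lemma coefBDn X k : coefB X (k + n) = hol X *m coefB X k *m invmx (hol X).
Proof.
rewrite /coefB (_ : ((k + n) %/ n)%N = (k %/ n).+1).
  rewrite exprS exprSr -!mulmxA.
  by congr (_ *m (_ *m (X _ *m _))); apply: val_inj; rewrite /= modnDr.
by rewrite divnDr// divnn n_gt0 addn1.
Qed.

Lemma expmx_unit p (M : 'M[R]_p) q : M \in unitmx -> M ^+ q \in unitmx.
Proof.
move=> Mu; elim: q => [|q IH]; first exact: unitmx1.
by rewrite exprS [_ * _]/(_ *m _) unitmx_mul Mu.
Qed.

Lemma coefA_unit X k : (forall i, X i \in unitmx) -> coefA X k \in unitmx.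
Proof. by move=> Xu; rewrite !unitmx_mul !expmx_unit ?unitmx_inv//= Xu. Qed.

Lemma coefB_unit X k : (forall i, X i \in unitmx) -> coefB X k \in unitmx.
Proof. by move=> Xu; rewrite !unitmx_mul !expmx_unit ?unitmx_inv//= Xu. Qed.

(* [X] holds the coefficients of a (non-periodic) change [u] of the lift [w]
   for which all the coefficients [C] are [1]. *)
Definition normalizes w X := exists u : nat -> 'M[R]_(N + N + N, N),
  exists p : nat -> 'M[R]_N,
  [/\ forall k, p k \in unitmx /\ u k = lift_seq w k *m p k,
      forall k, frame u k \in unitmx,
      forall k, u k.+3 = u k *m coefA X k + u k.+1 *m coefB X k + u k.+2 &
      forall k, u (k + n)%N *m hol X = w.2 *m u k].

(** The two normalized lifts differ by [g] on the left and matrices [h k] on the right. Comparing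
    recurrences whose third coefficient is 1 makes [h] constant, and a constant [h] acts on the
    invariants by conjugation. *)
Lemma normalizes_conj w w' X X' (g : 'M[R]_(N + N + N)) (G : 'I_n -> 'M[R]_N) :
  normalizes w X -> normalizes w' X' -> w.2 \in unitmx ->
  (forall i, X i \in unitmx) -> (forall i, X' i \in unitmx) ->
  g \in unitmx -> (forall i, G i \in unitmx) ->
  (forall i, w'.1 i = g *m w.1 i *m G i) -> w'.2 = g *m w.2 *m invmx g ->
  exists2 h, h \in unitmx & forall i, X' i = h *m X i *m invmx h.
Proof.
move=> [u [p [pu fu urec umon]]] [u' [p' [pu' fu' urec' umon']]].
move=> Mu Xu Xu' gu Gu w1 w2.
have wq q : w'.2 ^+ q *m g = g *m w.2 ^+ q.
  elim: q => [|q IH]; first by rewrite mul1mx mulmx1.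
  by rewrite !exprS -mulmxA IH w2 !mulmxA mulmxKV.
have vE k : lift_seq w' k = g *m lift_seq w k *m G (ord_modn n_gt0 k).
  by rewrite /lift_seq w1 !mulmxA wq.
pose h k := invmx (p k) *m G (ord_modn n_gt0 k) *m p' k.
have hu k : h k \in unitmx.
  by rewrite !unitmx_mul unitmx_inv Gu (pu k).1 (pu' k).1.
have uE k : u' k = g *m (u k *m h k).
  have [pku ukE] := pu k; have [_ ->] := pu' k.
  by rewrite vE ukE /h -!mulmxA (mulKVmx pku).
have recE k : [/\ coefA X k *m h k.+3 = h k *m coefA X' k,
    coefB X k *m h k.+3 = h k.+1 *m coefB X' k & h k.+3 = h k.+2].
  have := urec' k; rewrite !uE urec -!mulmxA -!mulmxDr => /(can_inj (mulKmx gu)).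
  rewrite !mulmxDl -!mulmxA => /(frame_inj (fu k)) [-> -> ->].
  by [].
have cancelu k (x y : 'M[R]_N) : u k *m x = u k *m y -> x = y.
  move=> e; have := @frame_inj _ _ u k x 0 0 y 0 0 (fu k).
  by rewrite !mulmx0 !addr0 => /(_ e)[].
have monE k : h (k + n)%N *m hol X' = hol X *m h k.
  have := umon' k; rewrite !uE w2 -!mulmxA (mulKmx gu) => /(can_inj (mulKmx gu)).
  by rewrite [w.2 *m _]mulmxA -umon -!mulmxA => /cancelu.
(* The recurrence gives constancy from index 2 on; the holonomy relation [monE] carries it from
   [l + n] back to [l], down to the indices 1 and 0. *)
have hstep j k : (j <= k)%N -> h k.+1 = h k.
  have : forall j, (j <= 2)%N -> forall k, (2 - j <= k)%N -> h k.+1 = h k.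
    elim=> [_ [|[|i]] // _|i IH i2 l li]; first by have [_ _] := recE i.
    have e : h (l + n).+1 = h (l + n)%N by apply: IH; lia.
    apply: (can_inj (mulKmx (Xu (Ordinal idxP_subproof)))).
    by rewrite -[X _]/(hol X) -!monE addSn e.
  by move=> H _; apply: (H 2%N).
have hE k : h k = h 0%N by elim: k => // k IH; rewrite (hstep 0%N).
have hu0 := hu 0%N.
have conjE (x y : 'M[R]_N) : x *m h 0%N = h 0%N *m y ->
    y = invmx (h 0%N) *m x *m invmx (invmx (h 0%N)).
  by move=> e; rewrite invmxK -mulmxA e mulKmx.
exists (invmx (h 0%N)); first by rewrite unitmx_inv.
have eP : hol X' = invmx (h 0%N) *m hol X *m invmx (invmx (h 0%N)).
  by apply: conjE; rewrite -(monE 0%N) hE.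
move=> i; have /(congr1 (fun Z : tuples => Z i)) :
    X' = (fun i => invmx (h 0%N) *m X i *m invmx (invmx (h 0%N))).
  apply: tuples_eq => // k kn.
    rewrite -coefA_small// -coefA_small//; apply: conjE.
    by have [+ _ _] := recE k; rewrite !hE.
  rewrite -coefB_small// -coefB_small//; apply: conjE.
  by have [_ + _] := recE k; rewrite !hE.
by [].
Qed.

Lemma normalizes_lift_equiv w w' X X' (h : 'M[R]_N) :
  normalizes w X -> normalizes w' X' ->
  (forall i, X i \in unitmx) ->
  h \in unitmx -> (forall i, X' i = h *m X i *m invmx h) ->
  exists g : 'M[R]_(N + N + N), exists G : 'I_n -> 'M[R]_N,
    [/\ g \in unitmx, forall i, G i \in unitmx,
        forall i, w'.1 i = g *m w.1 i *m G i &
        w'.2 = g *m w.2 *m invmx g].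
Proof.
move=> [u [p [pu fu urec umon]]] [u' [p' [pu' fu' urec' umon']]] Xu hu XE.
have PE : hol X' *m h = h *m hol X by rewrite /hol XE mulmxKV.
have Pu : hol X \in unitmx by exact: Xu.
have Pu' : hol X' \in unitmx.
  by rewrite /hol XE !unitmx_mul hu unitmx_inv hu /= andbT; exact: Xu.
have PVE : invmx (hol X') *m h = h *m invmx (hol X).
  by apply: (can_inj (mulKmx Pu')); rewrite mulKVmx// mulmxA PE mulmxK.
have powE (x y : 'M[R]_N) q : x *m h = h *m y -> x ^+ q *m h = h *m y ^+ q.
  move=> e; elim: q => [|q IH]; first by rewrite mul1mx mulmx1.
  by rewrite !exprS -mulmxA IH !mulmxA e.
have AE k : coefA X' k *m h = h *m coefA X k.
  by rewrite /coefA XE -!mulmxA (powE _ _ _ PVE) !mulmxA mulmxKV// (powE _ _ _ PE).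
have BE k : coefB X' k *m h = h *m coefB X k.
  by rewrite /coefB XE -!mulmxA (powE _ _ _ PVE) !mulmxA mulmxKV// (powE _ _ _ PE).
(* [g] is forced by the first frame; the recurrences, whose coefficients are conjugate by [h],
   propagate [g *m u k = u' k *m h] to every [k]. *)
pose D := row_mx (row_mx (u' 0%N *m h) (u' 1%N *m h)) (u' 2%N *m h).
pose g := D *m invmx (frame u 0).
have gframe : g *m frame u 0 = D by rewrite /g mulmxKV.
have [g0 g1 g2] : [/\ g *m u 0%N = u' 0%N *m h, g *m u 1%N = u' 1%N *m h &
    g *m u 2%N = u' 2%N *m h].
  move: gframe; rewrite /frame /D !mul_mx_row.
  by move=> /eq_row_mx[/eq_row_mx[-> ->] ->].
have guE k : g *m u k = u' k *m h.
  suff : [/\ g *m u k = u' k *m h, g *m u k.+1 = u' k.+1 *m h &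
    g *m u k.+2 = u' k.+2 *m h] by case.
  elim: k => [|k [e0 e1 e2]] //; split => //.
  rewrite urec urec'; move: (AE k) (BE k).
  move: (coefA X k) (coefB X k) (coefA X' k) (coefB X' k) => a b a' b' ae be.
  by rewrite !mulmxDr !mulmxDl !mulmxA e0 e1 e2 -!mulmxA ae be.
have gu : g \in unitmx.
  apply: (@frame_unit_cols _ _ _ u' 0 (u 0%N *m invmx h) (u 1%N *m invmx h)
    (u 2%N *m invmx h)) => //; by rewrite mulmxA guE mulmxK.
have w2 : w'.2 *m g = g *m w.2.
  have e k : w'.2 *m g *m u k = g *m w.2 *m u k.
    rewrite -mulmxA guE mulmxA -umon' -mulmxA PE -[RHS]mulmxA -umon.
    by rewrite [RHS]mulmxA guE -mulmxA.
  apply: (can_inj (mulmxK (fu 0%N))).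
  by rewrite /frame !mul_mx_row !e.
(* Substituting [u = V p] and [u' = V' p'] in [g *m u i = u' i *m h] and solving for [V'] gives this
   change of lift. *)
exists g, (fun i => p i *m invmx h *m invmx (p' i)); split => //.
- by move=> i; rewrite !unitmx_mul !unitmx_inv hu (pu i).1 (pu' i).1.
- move=> i; rewrite -!(lift_seq_ord n_gt0).
  have [pi_u uiE] := pu i; have [pi_u' uiE'] := pu' i.
  move: uiE uiE'; move: (lift_seq w i) (lift_seq w' i) => a a' ui ui'.
  by rewrite !mulmxA -(mulmxA g) -ui guE mulmxK// ui' mulmxK.
- by rewrite -w2 mulmxK.
Qed.

End NormalizedLifts.

(** * The maps between lifts and tuples *)

Section CoordinatesOfLift.
Variables (R : realType) (n N : nat).
Hypothesis n_gt0 : (0 < n)%N.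

Local Notation tuples := (prod_topology (fun _ : 'I_(2 * n + 1) => 'M[R]_N)).
Local Notation lift_seq := (@lift_seq R n N n_gt0).
Implicit Types (X Y : tuples) (w : lift_space R n N).

Lemma invmxM p (A B : 'M[R]_p) : A \in unitmx -> B \in unitmx ->
  invmx (A *m B) = invmx B *m invmx A.
Proof.
move=> Au Bu; have ABu : A *m B \in unitmx by rewrite unitmx_mul Au.
apply: (can_inj (mulKmx ABu)).
by rewrite mulmxV// !mulmxA mulmxK// mulmxV.
Qed.

Definition lift_coef w k : 'M[R]_(N + N + N, N) :=
  invmx (frame (lift_seq w) k) *m lift_seq w k.+3.
Definition liftA w k : 'M[R]_N := usubmx (usubmx (lift_coef w k)).
Definition liftB w k : 'M[R]_N := dsubmx (usubmx (lift_coef w k)).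
Definition liftC w k : 'M[R]_N := dsubmx (lift_coef w k).

(* The product of the [C_j] for [-2 <= j < k - 2]; the index [j] is shifted by
   [2 n] to stay in [nat]. *)
Fixpoint gauge w k : 'M[R]_N :=
  if k is l.+1 then gauge w l *m liftC w (l + (n.-1).*2) else 1%:M.

(** Coefficients of the recurrence satisfied by [lift_seq w k *m invmx (gauge w k)]; its third
    coefficient is 1 by [gauge3]. *)
Definition normA w k := gauge w k *m liftA w k *m invmx (gauge w k.+3).
Definition normB w k := gauge w k.+1 *m liftB w k *m invmx (gauge w k.+3).

Definition normal_tuple w : tuples := tuple_of (normA w) (normB w) (gauge w n).

Section FixedLift.
Variable w : lift_space R n N.
Hypothesis wTL : TL_set w.

Let Mu : w.2 \in unitmx. Proof. by have [] := (TL_setP n_gt0 w).1 wTL. Qed.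
Let fu k : frame (lift_seq w) k \in unitmx.
Proof. by have [_ /(_ k)[]] := (TL_setP n_gt0 w).1 wTL. Qed.

Lemma lift_coefP k : [/\ liftA w k \in unitmx, liftB w k \in unitmx,
  liftC w k \in unitmx & lift_seq w k.+3 = lift_seq w k *m liftA w k +
    lift_seq w k.+1 *m liftB w k + lift_seq w k.+2 *m liftC w k].
Proof.
have [_ /(_ k)[_ [A [B [C [Au Bu Cu e]]]]]] := (TL_setP n_gt0 w).1 wTL.
have cE : lift_coef w k = tri_col A B C.
  by rewrite /lift_coef e -frame_tri mulKmx.
have -> : liftA w k = A by rewrite /liftA cE /tri_col !col_mxKu.
have -> : liftB w k = B by rewrite /liftB cE /tri_col col_mxKu col_mxKd.
by have -> : liftC w k = C by rewrite /liftC cE /tri_col col_mxKd.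
Qed.

Lemma lift_coefDn k : lift_coef w (k + n) = lift_coef w k.
Proof.
have fE : frame (lift_seq w) (k + n) = w.2 *m frame (lift_seq w) k.
  by rewrite /frame -!addSn !lift_seqDn -!mul_mx_row.
by rewrite /lift_coef fE -!addSn lift_seqDn invmxM// -mulmxA mulKmx.
Qed.

Lemma gauge_unit k : gauge w k \in unitmx.
Proof.
elim: k => [|k IH]; first exact: unitmx1.
by rewrite /= unitmx_mul IH; have [] := lift_coefP (k + (n.-1).*2).
Qed.

Lemma gauge3 k : gauge w k.+3 = gauge w k.+2 *m liftC w k.
Proof.
rewrite [LHS]/=; congr (_ *m _).
rewrite /liftC -(lift_coefDn k) -(lift_coefDn (k + n)).
by congr (dsubmx (lift_coef w _)); lia.
Qed.

(** The matrices C are periodic, so a product over [k + n] terms splits off a full period. This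
    makes [gauge w n] the holonomy by which the normalized coefficients are conjugated after one
    period. *)
Lemma gaugeDn k : gauge w (k + n) = gauge w n *m gauge w k.
Proof.
elim: k => [|k IH]; first by rewrite mulmx1.
rewrite addSn /= IH -mulmxA; congr (_ *m (_ *m _)).
rewrite /liftC -(lift_coefDn (k + _)); congr (dsubmx (lift_coef w _)); lia.
Qed.

Lemma hol_normal_tuple : hol n_gt0 (normal_tuple w) = gauge w n.
Proof.
rewrite /hol /normal_tuple /tuple_of /=.
by rewrite ltnn ifF//; apply/negbTE; lia.
Qed.

Lemma periodic_conj (P : 'M[R]_N) (a b : nat -> 'M[R]_N) :
  (forall k, (k < n)%N -> a k = b k) ->
  (forall k, a (k + n)%N = P *m a k *m invmx P) ->
  (forall k, b (k + n)%N = P *m b k *m invmx P) -> a =1 b.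
Proof.
move=> e an bn k; rewrite (divn_eq k n) (addnC (k %/ n * n)%N).
elim: (k %/ n)%N => [|q IH]; first by rewrite mul0n addn0; exact/e/ltn_pmod.
by rewrite mulSnr (addnA (k %% n)%N) an bn IH.
Qed.

Lemma coefA_normal_tuple k : coefA n_gt0 (normal_tuple w) k = normA w k.
Proof.
apply: (periodic_conj (P := gauge w n) (b := normA w)) => [j jn|j|j].
- by rewrite coefA_small// /normal_tuple /tuple_of /= modn_small// jn.
- by rewrite coefADn hol_normal_tuple.
rewrite /normA -!addSn !gaugeDn /liftA lift_coefDn invmxM ?gauge_unit//.
by rewrite !mulmxA.
Qed.

Lemma coefB_normal_tuple k : coefB n_gt0 (normal_tuple w) k = normB w k.
Proof.
apply: (periodic_conj (P := gauge w n) (b := normB w)) => [j jn|j|j].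
- rewrite coefB_small// /normal_tuple /tuple_of /= modn_small//.
  by rewrite ifF ?ifT ?addKn//; [lia | apply/negbTE; lia].
- by rewrite coefBDn hol_normal_tuple.
rewrite /normB -!addSn !gaugeDn /liftB lift_coefDn invmxM ?gauge_unit//.
by rewrite !mulmxA.
Qed.

Lemma normal_tuple_unit i : normal_tuple w i \in unitmx.
Proof.
rewrite /normal_tuple /tuple_of; case: ifP => _.
  by have [Au _ _ _] := lift_coefP i; rewrite !unitmx_mul unitmx_inv !gauge_unit Au.
case: ifP => _; last exact: gauge_unit.
have [_ Bu _ _] := lift_coefP (i - n).
by rewrite unitmx_mul unitmx_inv gauge_unit andbT unitmx_mul gauge_unit Bu.
Qed.

Lemma normal_tuple_normalizes : normalizes n_gt0 w (normal_tuple w).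
Proof.
exists (fun k => lift_seq w k *m invmx (gauge w k)), (fun k => invmx (gauge w k)).
have gu k : invmx (gauge w k) \in unitmx by rewrite unitmx_inv gauge_unit.
split=> // k.
- exact: (frame_gauge (p := fun k => invmx (gauge w k)) gu _ (fu k)).
- rewrite coefA_normal_tuple coefB_normal_tuple /normA /normB.
  have [_ _ Cu ->] := lift_coefP k.
  have -> : invmx (gauge w k.+2) = liftC w k *m invmx (gauge w k.+3).
    by rewrite gauge3 invmxM ?gauge_unit// mulKVmx.
  have := gauge_unit k; have := gauge_unit k.+1.
  move: (gauge w k) (gauge w k.+1) (gauge w k.+3) (liftA w k) (liftB w k)
    (liftC w k) => g0 g1 g3 a b c g1u g0u.
  move: (lift_seq w k) (lift_seq w k.+1) (lift_seq w k.+2) => x y z.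
  by rewrite !mulmxDl !mulmxA !mulmxKV.
- rewrite hol_normal_tuple gaugeDn invmxM ?gauge_unit// lift_seqDn.
  by rewrite -!mulmxA mulVmx ?gauge_unit// mulmx1.
Qed.

End FixedLift.

(** The state of the recursion is three consecutive terms, starting from the standard frame. *)
Fixpoint lift_frame X k : 'M[R]_(N + N + N, N) * 'M[R]_(N + N + N, N) *
    'M[R]_(N + N + N, N) :=
  if k is l.+1 then
    let s := lift_frame X l in
    (s.1.2, s.2, s.1.1 *m coefA n_gt0 X l + s.1.2 *m coefB n_gt0 X l + s.2)
  else (tri_col 1%:M 0 0, tri_col 0 1%:M 0, tri_col 0 0 1%:M).

Definition normal_seq X k := (lift_frame X k).1.1.

(** The monodromy has to send u_k to u_(k+n) P; the frame at 0 being the identity, its block columns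
    are these images for k = 0, 1, 2. *)
Definition normal_lift X : lift_space R n N :=
  (fun i : 'I_n => normal_seq X i,
   row_mx (row_mx (normal_seq X n *m hol n_gt0 X) (normal_seq X n.+1 *m hol n_gt0 X))
          (normal_seq X n.+2 *m hol n_gt0 X)).

Section FixedTuple.
Variable X : tuples.
Hypothesis Xu : forall i, X i \in unitmx.

Let P := hol n_gt0 X.
Let Pu : P \in unitmx. Proof. exact: Xu. Qed.

Lemma normal_seq3 k : normal_seq X k.+3 =
  normal_seq X k *m coefA n_gt0 X k + normal_seq X k.+1 *m coefB n_gt0 X k +
  normal_seq X k.+2.
Proof. by []. Qed.

Lemma normal_seq_frame k : frame (normal_seq X) k \in unitmx.
Proof.
elim: k => [|k IH].
  suff -> : frame (normal_seq X) 0 = 1%:M by exact: unitmx1.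
  rewrite /frame /normal_seq /= /tri_col.
  rewrite -block_mxEh block_mxEv -block_mxEh row_mx0 col_mx0.
  by rewrite -block_mxEh -!scalar_mx_block.
have Au := coefA_unit n_gt0 k Xu.
set A := coefA n_gt0 X k in Au; set B := coefB n_gt0 X k.
(* [A] being invertible, the recurrence can be solved for the term of index [k] in the next
   frame. *)
apply: (@frame_unit_cols _ _ _ (normal_seq X) k
  (tri_col (- (B *m invmx A)) (- invmx A) (invmx A))
  (tri_col 1%:M 0 0) (tri_col 0 1%:M 0) _ _ _ IH).
- rewrite frame_tri normal_seq3 -/A -/B !mulmxN !mulmxDl mulmxK// mulmxA.
  by rewrite addrAC !addrA addrK addrAC addNr add0r.
- by rewrite frame_tri mulmx1 !mulmx0 !addr0.
- by rewrite frame_tri mulmx1 !mulmx0 addr0 add0r.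
Qed.

(** Holds on the first frame by construction and propagates because the coefficients are conjugated
    by [P] after [n] steps. *)
Lemma normal_lift_monodromy k :
  normal_seq X (k + n) *m P = (normal_lift X).2 *m normal_seq X k.
Proof.
suff : [/\ normal_seq X (k + n) *m P = (normal_lift X).2 *m normal_seq X k,
    normal_seq X (k.+1 + n) *m P = (normal_lift X).2 *m normal_seq X k.+1 &
    normal_seq X (k.+2 + n) *m P = (normal_lift X).2 *m normal_seq X k.+2] by case.
elim: k => [|k [e0 e1 e2]].
  by split; rewrite /= !mul_row_col ?mulmx1 ?mulmx0 ?addr0 ?add0r.
split => //; rewrite !addSn !normal_seq3 coefADn coefBDn -/P.
move: e0 e1 e2; rewrite !addSn.
move: (coefA n_gt0 X k) (coefB n_gt0 X k) => a b.
move: (normal_seq X k) (normal_seq X k.+1) (normal_seq X k.+2) => x y z.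
move: (normal_seq X (k + n)) (normal_seq X (k + n).+1) (normal_seq X (k + n).+2).
move=> x' y' z' e0 e1 e2.
by rewrite !mulmxDl !mulmxDr !mulmxA !mulmxKV// e0 e1 e2.
Qed.

(** The normalized sequence satisfies u_(k+n) P = M u_k and the twisted lift V_(k+n) = M V_k, so
    each completed period contributes a factor [P]. *)
Lemma normal_lift_seq k :
  lift_seq (normal_lift X) k = normal_seq X k *m P ^+ (k %/ n).
Proof.
apply: (periodic_uniq n_gt0 (M := (normal_lift X).2)
  (v := fun k => normal_seq X k *m P ^+ (k %/ n))) => [j|j|i].
- exact: lift_seqDn.
- rewrite divnDr// divnn n_gt0 (addn1 (j %/ n)) exprS.
  transitivity (normal_seq X (j + n) *m P *m P ^+ (j %/ n)).
    by rewrite -mulmxA.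
  by rewrite normal_lift_monodromy mulmxA.
- by rewrite lift_seq_ord divn_small// mulmx1.
Qed.

Lemma normal_lift_normalizes : normalizes n_gt0 (normal_lift X) X.
Proof.
exists (normal_seq X), (fun k => invmx (P ^+ (k %/ n))); split => k.
- rewrite unitmx_inv expmx_unit// normal_lift_seq mulmxK//.
  exact: expmx_unit.
- exact: normal_seq_frame.
- exact: normal_seq3.
- exact: normal_lift_monodromy.
Qed.

Lemma normal_lift_TL : TL_set (normal_lift X).
Proof.
apply/(TL_setP n_gt0); split.
  apply: (@frame_unit_cols _ _ _ (normal_seq X) n (tri_col (invmx P) 0 0)
    (tri_col 0 (invmx P) 0) (tri_col 0 0 (invmx P))) (normal_seq_frame n).
  - by rewrite !mul_row_col !mulmx0 !addr0 mulmxK.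
  - by rewrite !mul_row_col !mulmx0 addr0 add0r mulmxK.
  - by rewrite !mul_row_col !mulmx0 !add0r mulmxK.
have Pku k : P ^+ (k %/ n) \in unitmx by exact: expmx_unit.
move=> k; split.
  exact: (frame_gauge (p := fun j => P ^+ (j %/ n)) Pku normal_lift_seq
    (normal_seq_frame k)).
have Piu j : invmx (P ^+ (j %/ n)) \in unitmx by rewrite unitmx_inv.
exists (invmx (P ^+ (k %/ n)) *m coefA n_gt0 X k *m P ^+ (k.+3 %/ n)),
  (invmx (P ^+ (k.+1 %/ n)) *m coefB n_gt0 X k *m P ^+ (k.+3 %/ n)),
  (invmx (P ^+ (k.+2 %/ n)) *m P ^+ (k.+3 %/ n)).
have Au := coefA_unit n_gt0 k Xu; have Bu := coefB_unit n_gt0 k Xu.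
split.
- by rewrite unitmx_mul Pku andbT unitmx_mul Piu Au.
- by rewrite unitmx_mul Pku andbT unitmx_mul Piu Bu.
- by rewrite unitmx_mul Pku Piu.
rewrite !normal_lift_seq normal_seq3.
move: (coefA n_gt0 X k) (coefB n_gt0 X k) => a b.
move: (normal_seq X k) (normal_seq X k.+1) (normal_seq X k.+2) => x y z.
by rewrite !mulmxDl !mulmxA !mulmxK.
Qed.

End FixedTuple.

End CoordinatesOfLift.

(** * Continuity of both maps *)

Section CoordinatesContinuity.
Variables (R : realType) (n N : nat).
Hypothesis n_gt0 : (0 < n)%N.
Variables (T : Type) (F : set_system T).
Hypothesis FF : Filter F.

Local Notation tuples := (prod_topology (fun _ : 'I_(2 * n + 1) => 'M[R]_N)).

Section Lift.
Variables (w : T -> lift_space R n N) (w0 : lift_space R n N).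
Hypotheses (w0TL : TL_set w0) (ww0 : w @ F --> w0).

Lemma cvg_lift_seq k : lift_seq n_gt0 (w x) k @[x --> F] --> lift_seq n_gt0 w0 k.
Proof.
apply: cvg_mulmx.
  by apply: cvg_expmx; apply: cvg_comp ww0 _; exact: cvg_snd.
apply: (cvg_proj (f := fun x => (w x).1) (Y := w0.1)).
by apply: cvg_comp ww0 _; exact: cvg_fst.
Qed.

Lemma cvg_lift_coef k : lift_coef n_gt0 (w x) k @[x --> F] --> lift_coef n_gt0 w0 k.
Proof.
apply: cvg_mulmx; last exact: cvg_lift_seq.
apply: cvg_invmx; first by have [_ /(_ k)[]] := (TL_setP n_gt0 w0).1 w0TL.
by apply: cvg_row_mx; [apply: cvg_row_mx|]; exact: cvg_lift_seq.
Qed.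

Lemma cvg_gauge k : gauge n_gt0 (w x) k @[x --> F] --> gauge n_gt0 w0 k.
Proof.
elim: k => [|k IH] /=; first exact: cvg_cst.
by apply: cvg_mulmx => //; apply: cvg_dsubmx; exact: cvg_lift_coef.
Qed.

Lemma cvg_normal_tuple :
  normal_tuple n_gt0 (w x) @[x --> F] --> normal_tuple n_gt0 w0.
Proof.
have cg k : invmx (gauge n_gt0 (w x) k) @[x --> F] --> invmx (gauge n_gt0 w0 k).
  by apply: cvg_invmx; [exact: gauge_unit | exact: cvg_gauge].
apply: cvg_prod_topology => i; rewrite /normal_tuple /tuple_of.
case: ifP => _; last case: ifP => _.
- apply: cvg_mulmx; last exact: cg.
  apply: cvg_mulmx; first exact: cvg_gauge.
  by apply: cvg_usubmx; apply: cvg_usubmx; exact: cvg_lift_coef.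
- apply: cvg_mulmx; last exact: cg.
  apply: cvg_mulmx; first exact: cvg_gauge.
  by apply: cvg_dsubmx; apply: cvg_usubmx; exact: cvg_lift_coef.
- exact: cvg_gauge.
Qed.

End Lift.

Section Tuple.
Variables (X : T -> tuples) (X0 : tuples).
Hypotheses (X0u : forall i, X0 i \in unitmx) (XX0 : X @ F --> X0).

Lemma cvg_hol : hol n_gt0 (X x) @[x --> F] --> hol n_gt0 X0.
Proof. exact: cvg_proj. Qed.

Lemma cvg_coefA k : coefA n_gt0 (X x) k @[x --> F] --> coefA n_gt0 X0 k.
Proof.
apply: cvg_mulmx.
  by apply: cvg_mulmx; [apply: cvg_expmx; exact: cvg_hol | exact: cvg_proj].
apply: cvg_expmx; apply: cvg_invmx; [exact: X0u | exact: cvg_hol].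
Qed.

Lemma cvg_coefB k : coefB n_gt0 (X x) k @[x --> F] --> coefB n_gt0 X0 k.
Proof.
apply: cvg_mulmx.
  by apply: cvg_mulmx; [apply: cvg_expmx; exact: cvg_hol | exact: cvg_proj].
apply: cvg_expmx; apply: cvg_invmx; [exact: X0u | exact: cvg_hol].
Qed.

Lemma cvg_normal_seq k :
  normal_seq n_gt0 (X x) k @[x --> F] --> normal_seq n_gt0 X0 k.
Proof.
suff : [/\ normal_seq n_gt0 (X x) k @[x --> F] --> normal_seq n_gt0 X0 k,
    normal_seq n_gt0 (X x) k.+1 @[x --> F] --> normal_seq n_gt0 X0 k.+1 &
    normal_seq n_gt0 (X x) k.+2 @[x --> F] --> normal_seq n_gt0 X0 k.+2] by case.
elim: k => [|k [e0 e1 e2]]; first by split; exact: cvg_cst.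
split => //; rewrite normal_seq3; under eq_cvg => x do rewrite normal_seq3.
apply: cvgD => //; apply: cvgD.
  by apply: cvg_mulmx => //; exact: cvg_coefA.
by apply: cvg_mulmx => //; exact: cvg_coefB.
Qed.

Lemma cvg_normal_lift : normal_lift n_gt0 (X x) @[x --> F] --> normal_lift n_gt0 X0.
Proof.
have cP k : normal_seq n_gt0 (X x) k *m hol n_gt0 (X x) @[x --> F] -->
            normal_seq n_gt0 X0 k *m hol n_gt0 X0.
  by apply: cvg_mulmx; [exact: cvg_normal_seq | exact: cvg_hol].
have c1 : (normal_lift n_gt0 (X x)).1 @[x --> F] --> (normal_lift n_gt0 X0).1.
  by apply: cvg_prod_topology => i; exact: cvg_normal_seq.
have c2 : (normal_lift n_gt0 (X x)).2 @[x --> F] --> (normal_lift n_gt0 X0).2.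
  by apply: cvg_row_mx; [apply: cvg_row_mx|]; exact: cP.
exact: (@cvg_pair _ _ _ F (nbhs (normal_lift n_gt0 X0).1)
  (nbhs (normal_lift n_gt0 X0).2) FF (nbhs_filter _) (nbhs_filter _) _ _ c1 c2).
Qed.

End Tuple.

End CoordinatesContinuity.

(** * The homeomorphism of moduli spaces *)

Section Moduli.
Variables (R : realType) (n N : nat).
Hypothesis n_gt0 : (0 < n)%N.

Local Notation TL := (TL R n N).
Local Notation GLm := (GL_tuples R (2 * n + 1) N).

Definition tuple_of_TL (w : TL) : GLm :=
  exist _ (normal_tuple n_gt0 (val w))
    (mem_set (normal_tuple_unit n_gt0 (set_mem (valP w)))).

Definition TL_of_tuple (X : GLm) : TL :=
  exist _ (normal_lift n_gt0 (val X))
    (mem_set (normal_lift_TL n_gt0 (set_mem (valP X)))).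

(** Both maps produce pairs related by [normalizes], and for such pairs lifts are equivalent exactly
    when tuples are conjugate. This gives compatibility with the relations as well as both round
    trips. *)
Lemma GP_homeo :
  exists f : GP R n N -> GL_tuples_mod_Ad R (2 * n + 1) N,
  exists g : GL_tuples_mod_Ad R (2 * n + 1) N -> GP R n N,
    [/\ cancel f g, cancel g f, continuous f & continuous g].
Proof.
have Xu (X : GLm) : forall i, val X i \in unitmx by exact: (set_mem (valP X)).
have wM (w : TL) : (val w).2 \in unitmx.
  by have [] := (TL_setP n_gt0 (val w)).1 (set_mem (valP w)).
have nF (w : TL) : normalizes n_gt0 (val w) (val (tuple_of_TL w)).
  exact: normal_tuple_normalizes (set_mem (valP w)).
have nG (X : GLm) : normalizes n_gt0 (val (TL_of_tuple X)) (val X).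
  exact: normal_lift_normalizes (Xu X).
have conjE (w w' : TL) (X X' : GLm) : normalizes n_gt0 (val w) (val X) ->
    normalizes n_gt0 (val w') (val X') -> lift_equiv w w' -> conj_equiv X X'.
  move=> nX nX' [g [G [gu Gu e1 e2]]].
  have [h hu hE] :=
    normalizes_conj nX nX' (wM w) (Xu X) (Xu X') gu Gu e1 e2.
  by exists h.
have liftE (w w' : TL) (X X' : GLm) : normalizes n_gt0 (val w) (val X) ->
    normalizes n_gt0 (val w') (val X') -> conj_equiv X X' -> lift_equiv w w'.
  by move=> nX nX' [h hu hE]; exact: normalizes_lift_equiv nX nX' (Xu X) hu hE.
have lift_refl (w : TL) : lift_equiv w w by apply/asboolP; exact: lift_equivb_refl.
have conj_refl (X : GLm) : conj_equiv X X by apply/asboolP; exact: conj_equivb_refl.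
apply: (@quotient_homeo TL GLm (lift_equiv_rel R n N)
  (conj_equiv_rel R (2 * n + 1) N) tuple_of_TL TL_of_tuple).
- move=> w; apply: (cvg_set_type (nbhs_filter w)).
  have cv : val x @[x --> nbhs w] --> (val w : lift_space R n N).
    exact: initial_continuous.
  exact: (cvg_normal_tuple (nbhs_filter w) (set_mem (valP w)) cv).
- move=> X; apply: (cvg_set_type (nbhs_filter X)).
  have cv : val x @[x --> nbhs X] -->
      (val X : prod_topology (fun _ : 'I_(2 * n + 1) => 'M[R]_N)).
    exact: initial_continuous.
  exact: (cvg_normal_lift (nbhs_filter X) (Xu X) cv).
- by move=> w w' /asboolP e; apply/asboolP; exact: conjE (nF w) (nF w') e.
- by move=> X X' /asboolP e; apply/asboolP; exact: liftE (nG X) (nG X') e.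
- by move=> w; apply/asboolP; exact: liftE (nG _) (nF w) (conj_refl _).
- by move=> X; apply/asboolP; exact: conjE (nF _) (nG X) (lift_refl _).
Qed.

End Moduli.

Theorem theorem4 (R : realType) (n N : nat) (n_gt0 : (0 < n)%N)
    (N_gt0 : (0 < N)%N) :
  (exists f : GP R n N -> GL_tuples_mod_Ad R (2 * n + 1) N,
   exists g : GL_tuples_mod_Ad R (2 * n + 1) N -> GP R n N,
     [/\ cancel f g, cancel g f, continuous f & continuous g]) /\
  has_dim R (GP R n N) (2 * n * N ^ 2 + 1)%N.
Proof.
have [f [g [fK gK cf cg]]] := GP_homeo R N n_gt0.
split; first by exists f, g.
apply: (has_dim_homeo fK gK cf cg).
case: N N_gt0 {f g fK gK cf cg} => // k _.
(* As n is positive there are at least three matrices: one for the companion form, one for the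
   eigenvector and one for the shear. *)
have lt0 : (0 < 2 * n + 1)%N by lia.
have lt1 : (1 < 2 * n + 1)%N by lia.
have lt2 : (2 < 2 * n + 1)%N by lia.
have i01 : Ordinal lt0 != Ordinal lt1 by [].
have := @has_dim_GL_tuples_mod_Ad R k _ (Ordinal lt0) (Ordinal lt1) (Ordinal lt2)
  isT isT isT.
by rewrite (card_free_entries k i01) addn1.
Qed.
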